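(* Let $G$ be a $2$-connected graph which is not a cycle. If $G$ is $\{K_{1,3},P_4\}$-$f_1$-heavy, then $G$ is pancyclic.
   Context: All graphs are finite and simple. Let $G$ be a graph on $n$ vertices, and $d(x)$ the degree of $x$ in $G$. For a subgraph $H$ and $x,y\in V(H)$, $d_H(x,y)$ is the length of a shortest $(x,y)$-path in $H$. An induced subgraph $H$ of $G$ is called $f_1$-heavy if for every pair of vertices $u,v\in V(H)$ with $d_H(u,v)=2$ we have $\max\{d(u),d(v)\}\geq (n+1)/2$ (degrees taken in $G$). For a graph $R$, $G$ is $R$-$f_1$-heavy if every induced subgraph of $G$ isomorphic to $R$ is $f_1$-heavy; for a family $\mathcal{R}$ of graphs, $G$ is $\mathcal{R}$-$f_1$-heavy if it is $R$-$f_1$-heavy for every $R\in\mathcal{R}$. $K_{1,3}$ is the claw and $P_4$ is the path on 4 vertices. A graph on $n$ vertices is pancyclic if it contains cycles of every length from $3$ to $n$. *)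

(* Defs.v *)
From mathcomp Require Import all_boot.
Set Implicit Arguments. Unset Strict Implicit. Unset Printing Implicit Defensive.

Section Graphs.
Variable T : finType.
Variable e : rel T.

Definition simple_graph : Prop := symmetric e /\ irreflexive e.

Definition deg (x : T) : nat := #|[set y | e x y]|.

Definition induced_iso (R : finType) (eR : rel R) (S : {set T}) : Prop :=
  exists f : R -> T,
    [/\ injective f, f @: setT = S & forall a b, e (f a) (f b) = eR a b].

Definition dist2_in (S : {set T}) (u v : T) : bool :=
  [&& u \in S, v \in S, u != v, ~~ e u v &
      [exists w in S, e u w && e w v]].

(* G[S] is f1-heavy: max{d(u),d(v)} >= (n+1)/2, written as 2*max >= n+1 *)
Definition f1_heavy (S : {set T}) : Prop :=
  forall u v, dist2_in S u v -> #|T|.+1 <= 2 * maxn (deg u) (deg v).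

Definition R_f1_heavy (R : finType) (eR : rel R) : Prop :=
  forall S : {set T}, induced_iso eR S -> f1_heavy S.

Definition connected_on (S : {set T}) : Prop :=
  forall x y, x \in S -> y \in S ->
    connect (fun a b => [&& e a b, a \in S & b \in S]) x y.

Definition two_connected : Prop :=
  2 < #|T| /\ connected_on setT /\ forall v, connected_on [set~ v].

Definition has_cycle_of_length (k : nat) : Prop :=
  exists s : seq T, size s = k /\ ucycle e s.

Definition pancyclic : Prop :=
  forall k, 3 <= k <= #|T| -> has_cycle_of_length k.

Definition graph_iso (R : finType) (eR : rel R) : Prop :=
  exists f : T -> R, bijective f /\ forall x y, eR (f x) (f y) = e x y.

End Graphs.

Definition cycle_rel (n : nat) : rel 'I_n :=
  fun i j => (i.+1 %% n == j) || (j.+1 %% n == i).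

Definition is_cycle_graph (T : finType) (e : rel T) : Prop :=
  2 < #|T| /\ graph_iso e (@cycle_rel #|T|).

Definition claw_rel : rel 'I_4 :=
  fun i j => (i != j) && ((nat_of_ord i == 0) || (nat_of_ord j == 0)).

Definition P4_rel : rel 'I_4 :=
  fun i j => (i.+1 == j) || (j.+1 == i).

(* Main.v *)
Require Import Defs.
From mathcomp Require Import all_boot.
From mathcomp Require Import zify.

(** Call a vertex heavy if its degree is at least (n+1)/2, and light otherwise.
    Two facts turn Hamilton cycles into cycles of all lengths, both by counting
    pairs of neighbours at a prescribed distance along the cycle: (a) a Hamilton
    cycle with two consecutive heavy vertices, and (b) a cycle missing exactly one
    vertex, which is heavy.

    Hamiltonicity.  Among the cycles through all heavy vertices in the graph where
    any two heavy vertices are joined, take a longest one C, and make it use as few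
    new edges as possible; Ore's crossing argument then removes all new edges.  If a
    path outside C joins x and y of C, the claw condition lets the cycle bypass x and
    y, and the P4 condition makes x and y adjacent to long stretches of C, so that x,
    the path and y can be inserted elsewhere, which contradicts the choice of C.

    Pancyclicity.  If (a) and (b) both fail for a Hamilton cycle C, heavy vertices are
    isolated on C and the two neighbours of a heavy vertex are not adjacent.  Then the
    light vertices induce disjoint cliques (the only other possibility is C4), each of
    them is a single segment of C, and a heavy vertex sees only the two segments and
    the two heavy vertices next to it.  With four or more heavy vertices, two
    non-consecutive ones have at most two common neighbours, whereas their degrees
    force three; with two or three of them, all cycles can be written down. *)

Set Implicit Arguments. Unset Strict Implicit. Unset Printing Implicit Defensive.

(* [lia] compares atoms syntactically, so the carrier of [T : finType] must be
   written in a single way. *)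
Ltac slia :=
  repeat match goal with H : ?P |- _ =>
    lazymatch P with
    | is_true (leq _ _) => fail
    | is_true (~~ leq _ _) => fail
    | @eq nat _ _ => fail
    | _ => clear H
    end end;
  cbv [Equality.sort fintype_Finite__to__eqtype_Equality] in *; lia.

Ltac perm_count :=
  apply/permP => ?; rewrite -?cats1;
  repeat progress rewrite /= ?count_cat ?count_rev; slia.

(** * Sequences and counting *)

Section Sequences.
Variable T : finType.
Implicit Types (e : rel T) (s : seq T).

Lemma path_rev_cons e z x s :
  symmetric e -> path e z (rev (x :: s)) = e z (last x s) && path e x s.
Proof.
move=> es; rewrite lastI rev_rcons /= rev_path; congr (_ && _).
by apply: eq_path => u v; rewrite es.
Qed.

Lemma last_rev_cons z x s : last z (rev (x :: s)) = x.
Proof. by rewrite rev_cons last_rcons. Qed.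

Lemma pigeonhole2 (A B D : {set T}) :
  A \subset D -> B \subset D -> #|D| < #|A| + #|B| -> exists2 x, x \in A & x \in B.
Proof.
move=> AD BD ltD; have [x /setIP[]|AB0] := pickP (mem (A :&: B)); first by exists x.
have AB : A :&: B = set0 by apply/setP=> x; rewrite [RHS]inE; apply: AB0.
suff: #|A| + #|B| <= #|D| by rewrite leqNgt ltD.
by rewrite -cardsUI AB cards0 addn0 subset_leq_card // subUset AD.
Qed.

Lemma iter_next u s i :
  uniq (u :: s) -> i <= size s -> iter i (next (u :: s)) u = nth u (u :: s) i.
Proof.
move=> us les; have := cycle_next us; rewrite /= rcons_path => /andP[p _].
have /fpathP[m def] := p.
have szm : size s = m by rewrite def size_traject.
have E : u :: s = traject (next (u :: s)) u m.+1 by rewrite trajectS -def.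
by rewrite [in RHS]E nth_traject // -szm ltnS.
Qed.

Lemma iter_next_inj s i : uniq s -> injective (iter i (next s)).
Proof. by move=> us; elim: i => //= i IH x y /(can_inj (prev_next us)) /IH. Qed.

Lemma mem_iter_next s i x : (iter i (next s) x \in s) = (x \in s).
Proof. by elim: i => //= i IH; rewrite mem_next. Qed.

End Sequences.

(** * From Hamilton cycles to pancyclicity *)

Section Pancyclicity.
Variables (T : finType) (e : rel T).
Hypotheses (esym : symmetric e) (eirr : irreflexive e).

(** The neighbours of [v] and their shift by [k - 2] places lie among the [n - 1] cycle vertices but
    number at least [n] together. So some neighbour [w] is [k - 2] steps after a neighbour [u], and
    the arc from [u] to [w] closes up through [v]. *)
Lemma pancyclic_of_missed_vertex v s :
  cycle e s -> uniq s -> v \notin s -> (size s).+1 = #|T| -> #|T| <= 2 * deg e v ->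
  pancyclic e.
Proof.
move=> cs us vs szs dv k /andP[k3 kn].
pose N := [set y | e v y].
have memS z : (z \in s) = (z != v).
  have [->|zv] := eqVneq z v; first exact: negbTE.
  have sub : {subset v :: s <= enum T} by move=> x; rewrite mem_enum.
  have uvs : uniq (v :: s) by rewrite /= vs.
  have [|_ /(_ z)] := uniq_min_size uvs sub; first by rewrite -cardE -szs.
  by rewrite mem_enum !inE (negbTE zv).
have NS (x : T) : x \in N -> x \in s.
  by rewrite inE memS; apply: contraTneq => ->; rewrite eirr.
have [||| w] := @pigeonhole2 T N (iter (k - 2) (next s) @: N) [set x in s].
- by apply/subsetP=> x; rewrite inE; apply: NS.
- by apply/subsetP=> x /imsetP[y /NS ys ->]; rewrite inE mem_iter_next.
- rewrite card_imset; last exact: iter_next_inj.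
  rewrite cardsE (card_uniqP us) addnn -mul2n -[#|N|]/(deg e v); slia.
rewrite inE => vw /imsetP[u]; rewrite inE => vu def.
have [i s' rots] : rot_to_spec s u by apply: rot_to; apply: NS; rewrite inE.
have us' : uniq (u :: s') by rewrite -rots rot_uniq.
have sz' : size s = (size s').+1 by rewrite -(size_rot i) rots.
have cs' : cycle e (u :: s') by rewrite -rots rot_cycle.
move: def; rewrite -(eq_iter (next_rot i us)) rots iter_next //; last by slia.
move: k3 kn; case: k => [|[|[|k]]] // _ kn; rewrite !subSS subn0 /= => def.
exists (v :: u :: take k.+1 s'); split.
  by rewrite /= size_takel //; slia.
have pt : path e u (take k.+1 s').
  by move: cs'; rewrite /= rcons_path -{1}(cat_take_drop k.+1 s') cat_path -andbA => /andP[].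
rewrite /ucycle /= rcons_path vu pt /=.
have -> : last u (take k.+1 s') = w.
  have lk : k < size s' by slia.
  by rewrite def -nth_last size_takel // nth_take //; apply: set_nth_default.
rewrite esym vw /=.
have ut : uniq (u :: take k.+1 s').
  by apply: subseq_uniq us'; rewrite /= eqxx take_subseq.
rewrite inE negb_or; move: ut => /= ->; rewrite andbT.
have vr : v \notin u :: s' by rewrite -rots mem_rot.
move: vr; rewrite inE negb_or => /andP[-> vs']; apply: contra vs'; exact: mem_take.
Qed.

(** Apart from each other, [x] and [y] have together more than [n - 2] neighbours on [c]. Hence a
    neighbour [w] of [x] lies [k - 3] places after a neighbour [u] of [y] in the cyclic order of
    [c]. *)
Lemma pancyclic_of_consecutive x y c :
  ucycle e (x :: y :: c) -> size (x :: y :: c) = #|T| -> #|T| < deg e x + deg e y ->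
  pancyclic e.
Proof.
move=> /andP[cyc uc] szc dxy k /andP[k3 kn].
have memS z : (z \in x :: y :: c).
  have sub : {subset x :: y :: c <= enum T} by move=> ?; rewrite mem_enum.
  have [|_ /(_ z)] := uniq_min_size uc sub; first by rewrite -cardE -szc.
  by rewrite mem_enum.
move: (uc); rewrite /= inE negb_or -andbA => /and4P[xy xc yc uc'].
move: cyc; rewrite /= rcons_path => /and3P[exy pc lc].
pose X := [set z | e x z] :\ y; pose Y := [set z | e y z] :\ x.
have cX : deg e x <= #|X|.+1 by rewrite /deg (cardsD1 y) -add1n leq_add2r leq_b1.
have cY : deg e y <= #|Y|.+1 by rewrite /deg (cardsD1 x) -add1n leq_add2r leq_b1.
have YS z : z \in Y -> z \in c.
  rewrite !inE => /andP[zx eyz]; move: (memS z); rewrite !inE (negbTE zx).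
  by case: eqP eyz => // ->; rewrite eirr.
have XS z : z \in X -> z \in c.
  rewrite !inE => /andP[zy exz]; move: (memS z); rewrite !inE (negbTE zy).
  by case: eqP exz => // ->; rewrite eirr.
have [||| w] := @pigeonhole2 T X (iter (k - 3) (next c) @: Y) [set x in c].
- by apply/subsetP=> z; rewrite inE; apply: XS.
- by apply/subsetP=> z /imsetP[t /YS ys ->]; rewrite inE mem_iter_next.
- rewrite card_imset; last exact: iter_next_inj.
  by rewrite cardsE (card_uniqP uc'); move: szc => /=; slia.
move=> Xw /imsetP[u Yu def]; have uinc := YS _ Yu.
move: Xw Yu; rewrite !inE => /andP[wy exw] /andP[ux eyu].
case/splitPr: uinc => [c1 c2] in pc lc szc uc uc' def xc yc *.
have rotE : rot (size c1) (c1 ++ u :: c2) = u :: c2 ++ c1 by rewrite rot_size_cat.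
have ur : uniq (u :: c2 ++ c1) by rewrite -rotE rot_uniq.
move: def; rewrite -(eq_iter (next_rot (size c1) uc')) rotE iter_next //; last first.
  by move: szc; rewrite /= !size_cat /=; slia.
have szc' : size c1 + size c2 = #|T| - 3 by move: szc; rewrite /= size_cat /=; slia.
case: (leqP (k - 3) (size c2)) => kc.
  rewrite -cat_cons nth_cat /= ltnS kc => def.
  exists (x :: y :: u :: take (k - 3) c2); split.
    by rewrite /= size_takel //; slia.
  move: pc; rewrite cat_path /= => /and3P[_ _ p2].
  have p2' : path e u (take (k - 3) c2).
    by move: p2; rewrite -{1}(cat_take_drop (k - 3) c2) cat_path => /andP[].
  have -> : (ucycle e [:: x, y, u & take (k - 3) c2]) =
            uniq [:: x, y, u & take (k - 3) c2].
    rewrite /ucycle /= rcons_path exy eyu p2' /=.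
    have -> : last u (take (k - 3) c2) = w.
      by rewrite def (last_nth u) size_takel // -[_ :: _]/(take (k - 3).+1 (u :: c2)) nth_take.
    by rewrite esym exw.
  apply: subseq_uniq uc; rewrite /= !eqxx.
  apply: subseq_trans (suffix_subseq _ _).
  by rewrite /= eqxx take_subseq.
rewrite -cat_cons nth_cat /= ltnNge kc /= => def.
have wc1 : w \in c1 by rewrite def mem_nth //; slia.
have iw : index w c1 = k - 3 - (size c2).+1.
  rewrite def index_uniq //; first slia.
  by move: uc'; rewrite cat_uniq => /andP[].
case/splitPr: wc1 => [d1 d2] in pc lc szc szc' uc uc' def xc yc rotE ur iw *.
have {}iw : size d1 = k - 3 - (size c2).+1.
  move: iw; rewrite index_cat /= eqxx addn0; case: ifP => // wd1.
  by move: uc'; rewrite -catA cat_uniq => /and3P[_ /hasPn/(_ w)]; rewrite mem_cat inE eqxx /= wd1 => /(_ isT).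
(* The shift has wrapped around the end of [c], where an edge may be missing: go from [x] to [w],
   backwards to [y], then to [u] and on to the end of [c]. *)
exists (x :: w :: rev (y :: d1) ++ u :: c2); split.
  by rewrite /= size_cat size_rev /=; slia.
move: pc lc; rewrite !(cat_path, last_cat) /= => /and3P[/and3P[pd1 ed1w pd2] _ pc2] lc2.
apply/andP; split.
  rewrite /= exw rcons_path cat_path path_rev_cons // last_cat /= last_rev_cons.
  by rewrite esym ed1w pd1 eyu pc2.
apply: (@subseq_uniq _ _ (x :: w :: rev (y :: d1) ++ d2 ++ u :: c2)).
  rewrite /= !eqxx; apply: cat_subseq => //; exact: suffix_subseq.
rewrite (perm_uniq (s2 := x :: y :: (d1 ++ w :: d2) ++ u :: c2)) //; perm_count.
Qed.

End Pancyclicity.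

(** * Extending cycles of the closure *)

Lemma connect_leave (T : finType) (g : rel T) (P : pred T) a b :
  connect g a b -> P a -> ~~ P b -> exists u v, [/\ P u, ~~ P v & g u v].
Proof.
move=> /connectP[p]; elim: p a => [|z p IH] a /=; first by move=> _ -> ->.
move=> /andP[gaz pz] def Pa Pb; have [Pz|nPz] := boolP (P z); first exact: (IH z).
by exists a, z.
Qed.

Lemma all_or_split (T : Type) (P : pred T) s :
  all (predC P) s \/ exists s1 z s2, [/\ s = s1 ++ z :: s2, all (predC P) s1 & P z].
Proof.
elim: s => [|x s [IH|[s1 [z [s2 [-> a1 Pz]]]]]]; first by left.
  have [Px|nPx] := boolP (P x); last by left; rewrite /= nPx.
  by right; exists [::], x, s.
have [Px|nPx] := boolP (P x); right; first by exists [::], x, (s1 ++ z :: s2).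
by exists (x :: s1), z, s2; rewrite /= nPx.
Qed.

Lemma path_or_split (T : Type) (R : rel T) x s :
  path R x s \/
  exists s1 z s2, [/\ s = s1 ++ z :: s2, path R x s1 & ~~ R (last x s1) z].
Proof.
elim: s x => [|y s IH] x; first by left.
have [Rxy|nRxy] := boolP (R x y); last by right; exists [::], y, s.
case: (IH y) => [ps|[s1 [z [s2 [-> p1 nR]]]]]; first by left; rewrite /= Rxy.
by right; exists (y :: s1), z, s2; rewrite /= Rxy.
Qed.

Lemma path_all_right (T : Type) (P : pred T) (R : rel T) x s :
  (forall u v, P u -> P v -> R u v) -> P x -> all P s -> path R x s.
Proof. by move=> PR; elim: s x => //= y s IH x Px /andP[Py Ps]; rewrite PR //= IH. Qed.

Lemma uniq_cat1 (T : eqType) (s : seq T) r rho :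
  uniq (s ++ r :: rho) -> uniq (s ++ [:: r]).
Proof. by rewrite -cat_rcons cat_uniq cats1 => /andP[]. Qed.

(* Cuts goals and premises about concatenated walks into single edges and the
   walks inside each segment. *)
Ltac glue es :=
  repeat progress rewrite /= ?rcons_path ?cat_path ?last_cat
                             ?(path_rev_cons _ _ _ es) ?last_rev_cons;
  repeat match goal with
  | |- is_true (_ && _) -> _ => case/andP
  | |- is_true _ -> _ => let H := fresh in move=> H
  end;
  repeat (apply/andP; split);
  first [assumption | by rewrite es | idtac].

(** * Paths outside a cycle attached at two of its vertices *)

Section Attachments.
Variables (T : finType) (e : rel T).
Hypothesis esym : symmetric e.
Hypothesis conn1 : forall v, connected_on e [set~ v].

(** The component of [r] outside [s] has a neighbour [x] in [s] and, since deleting [x] leaves the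
    graph connected, a second one [y]; a path inside the component joins them. *)
Lemma two_attachments (s : seq T) a b r :
  a \in s -> b \in s -> a != b -> r \notin s ->
  exists x y rho, [/\ x \in s, y \in s & x != y] /\ [/\
    path e x (rcons rho y), rho != [::] & uniq rho && all [predC s] rho].
Proof.
move=> as_ bs ab rs.
pose f u v := [&& e u v, u \notin s & v \notin s].
have fsym : connect_sym f.
  by apply: sym_connect_sym => u v; rewrite /f esym [X in _ && X]andbC.
have outS z : connect f r z -> z \notin s.
  case/connectP=> p; case/lastP: p => [|p w]; first by move=> _ ->.
  by rewrite last_rcons rcons_path => /andP[_ /and3P[_ _ ws]] ->.
have leave x0 c : c \in s -> c != x0 -> r != x0 -> 
    connected_on e [set~ x0] -> exists u v, [/\ connect f r u, v \in s, v != x0 & e u v].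
  move=> cs cx0 rx0 cn; have := cn r c; rewrite !inE => /(_ rx0 cx0).
  have nrc : ~~ connect f r c by apply: contraL cs; apply: outS.
  move=> /(connect_leave (P := connect f r)) /(_ (connect0 _ _) nrc) [u [v [ru rv]]].
  rewrite !inE => /and3P[euv ux vx]; exists u, v; split=> //.
  apply: contraR rv => vs; apply: (connect_trans ru (connect1 _)).
  by rewrite /f euv vs outS.
have rx x : x \in s -> r != x by apply: contraTneq => <-.
have [u1 [x [ru1 xs eu1x]]] : exists u v, [/\ connect f r u, v \in s & e u v].
  by have [|u [v [? ? ? ?]]] := leave b a as_ ab (rx _ bs); last exists u, v.
have [c cs cx] : exists2 c, c \in s & c != x.
  by have [<-|ax] := eqVneq a x; [exists b; rewrite // eq_sym | exists a].
have [u2 [y [ru2 ys yx eu2y]]] := leave x c cs cx (rx _ xs) (@conn1 x).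
have /connectP[p pp lp] : connect f u1 u2.
  by apply: (connect_trans _ ru2); rewrite fsym.
move: lp; case/shortenP: pp => p' pp' up' _ lp.
exists x, y, (u1 :: p'); split; first by rewrite eq_sym yx.
split=> //.
  rewrite /= rcons_path esym eu1x -lp eu2y andbT /=.
  by apply: sub_path pp' => ? ? /andP[].
rewrite up' /=; apply/andP; split; first exact: outS.
apply/allP=> z zp; apply: outS; apply: (connect_trans ru1).
by apply: (path_connect pp'); rewrite inE zp orbT.
Qed.

End Attachments.

(** * Longest closure cycles have no detours *)

Section Heavy.
Variables (T : finType) (e : rel T).
Hypotheses (esym : symmetric e) (eirr : irreflexive e).

Definition heavy x := #|T| < 2 * deg e x.
(** A heavy pair has degree sum above [n], so Ore's crossing argument applies to every added
    edge. *)
Definition clos : rel T := fun x y => e x y || [&& x != y, heavy x & heavy y].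

Hypothesis claw_heavy : forall x a b c,
  e x a -> e x b -> e x c -> a != b -> a != c -> b != c ->
  ~~ e a b -> ~~ e a c -> ~~ e b c -> heavy a || heavy b.
Hypothesis P4_heavy : forall a b c d,
  e a b -> e b c -> e c d -> ~~ e a c -> ~~ e b d -> ~~ e a d ->
  (heavy a || heavy c) && (heavy b || heavy d).

Lemma clos_sym : symmetric clos.
Proof. by move=> x y; rewrite /clos esym eq_sym [heavy x && _]andbC. Qed.

Lemma sub_clos : subrel e clos.
Proof. by move=> x y; rewrite /clos => ->. Qed.

Lemma clos_heavy x y : x != y -> heavy x -> heavy y -> clos x y.
Proof. by rewrite /clos => -> -> ->; rewrite orbT. Qed.

(** Only cycles containing all of [s] compete, because they still pass through every heavy vertex on
    [s]. *)
Definition no_longer (s : seq T) := forall s',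
  uniq s' -> {subset s <= s'} -> size s < size s' -> ~ cycle clos s'.

(* [x :: c1 ++ y :: c2] is a cycle through all heavy vertices, longest among the
   cycles of the closure, and [rho] is a path outside it from [x] to [y]. *)
Definition detour x c1 y c2 rho :=
  let s := x :: c1 ++ y :: c2 in
  [/\ [/\ cycle e s, no_longer s & forall h, heavy h -> h \in s],
      uniq (s ++ rho), path e x (rcons rho y) & rho != [::]].

Lemma no_longer_perm s s' : perm_eq s s' -> no_longer s -> no_longer s'.
Proof.
move=> ss nl t ut st szt; apply: (nl t) => // [x xs|].
  by apply: st; rewrite -(perm_mem ss).
by rewrite (perm_size ss).
Qed.

Lemma no_longer_insert s rho s' :
  no_longer s -> uniq (s ++ rho) -> rho != [::] -> perm_eq s' (s ++ rho) ->
  cycle clos s' -> False.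
Proof.
move=> nl us rho0 ps; apply: nl.
- by rewrite (perm_uniq ps).
- by move=> x xs; rewrite (perm_mem ps) mem_cat xs.
- by rewrite (perm_size ps) size_cat -{1}[size s]addn0 ltn_add2l; case: (rho) rho0.
Qed.

(** Together with [detour_rev], this carries a fact about one end and one direction over to the
    other end and the other direction. *)
Lemma detour_sym x c1 y c2 rho :
  detour x c1 y c2 rho -> detour y c2 x c1 (rev rho).
Proof.
move=> [[cs nl hs] us px rho0].
have ps : perm_eq (x :: c1 ++ y :: c2) (y :: c2 ++ x :: c1) by perm_count.
split.
- split; last by move=> h /hs; rewrite (perm_mem ps).
    by rewrite -cat_cons -rot_size_cat rot_cycle.
  exact: no_longer_perm ps nl.
- by rewrite -(perm_uniq (s1 := (x :: c1 ++ y :: c2) ++ rho)) //; perm_count.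
- have -> : rcons (rev rho) x = rev (x :: rho) by rewrite rev_cons.
  by move: px; rewrite path_rev_cons // rcons_path esym andbC.
- by rewrite -size_eq0 size_rev size_eq0.
Qed.

Lemma detour_rev x c1 y c2 rho :
  detour x c1 y c2 rho -> detour x (rev c2) y (rev c1) rho.
Proof.
move=> [[cs nl hs] us px rho0].
have ps : perm_eq (x :: c1 ++ y :: c2) (x :: rev c2 ++ y :: rev c1) by perm_count.
split=> //.
- split; last by move=> h /hs; rewrite (perm_mem ps).
    have : cycle e (rev (x :: c1 ++ y :: c2)).
      by rewrite rev_cycle (eq_cycle (e' := e)) // => u v; rewrite esym.
    rewrite rev_cons rev_cat rev_cons -cats1 -(rot_cycle (size (rcons (rev c2) y ++ rev c1))).
    by rewrite rot_size_cat cat_rcons.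
  exact: no_longer_perm ps nl.
- by rewrite -(perm_uniq (s1 := (x :: c1 ++ y :: c2) ++ rho)) //; perm_count.
Qed.

Lemma detour_light x c1 y c2 rho r :
  detour x c1 y c2 rho -> r \in rho -> ~~ heavy r.
Proof.
move=> [[_ _ hs] us _ _] rr; apply/negP => /hs rs; move: us.
by rewrite cat_uniq => /and3P[_ /hasPn/(_ r rr)]; rewrite /= rs.
Qed.

(** Otherwise [rho] fits between the consecutive vertices [x] and [y]. *)
Lemma detour_gap x y c2 rho : ~ detour x [::] y c2 rho.
Proof.
move=> [[cs nl _] us px rho0].
apply: (no_longer_insert nl us rho0 (s' := x :: rho ++ y :: c2)); first by perm_count.
apply: (sub_cycle sub_clos); move: cs px.
rewrite /= !(rcons_path, cat_path, last_cat) /= => /and3P[_ -> ->] /andP[-> ->].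
by [].
Qed.

(** Otherwise [r] alone fits between [x] and its successor [q]. *)
Lemma detour_next x q c1 y c2 r rho :
  detour x (q :: c1) y c2 (r :: rho) -> ~~ e r q.
Proof.
move=> [[cs nl _] us px _]; apply/negP => erq.
apply: (no_longer_insert nl (rho := [:: r]) (s' := x :: r :: q :: c1 ++ y :: c2)) => //.
- exact: uniq_cat1 us.
- by perm_count.
apply: (sub_cycle sub_clos); move: cs px => /= /andP[_ ->] /andP[-> _].
by rewrite erq.
Qed.

(** The light vertex [r] is adjacent to neither cycle neighbour of [x]. If these two are not
    adjacent, they form with [r] a claw centred at [x], so both are heavy. *)
Lemma detour_bypass x q c1 y c2 rho :
  detour x (q :: c1) y c2 rho -> clos (last y c2) q.
Proof.
case: rho => [|r rho] D; first by case: D.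
have erq := detour_next D.
have erp : ~~ e r (last y c2).
  move: (detour_rev D); case/lastP: c2 D => [|c2 p] D.
    by move/detour_gap.
  by rewrite rev_rcons last_rcons => /detour_next.
have rl : ~~ heavy r by apply: (detour_light D); rewrite inE eqxx.
move: D => [[cs nl hs] us px _].
have exr : e x r by move: px => /= /andP[].
have exq : e x q by move: cs => /= /andP[].
have exp : e x (last y c2).
  by move: cs; rewrite /= rcons_path last_cat /= [X in _ && (_ && X)]esym => /and3P[].
have qp : q != last y c2.
  have : q \notin c1 ++ y :: c2 by move: us; rewrite cat_uniq /= => /andP[/and3P[]].
  by apply: contraNneq => ->; rewrite mem_cat mem_last orbT.
have notr z : z \in x :: (q :: c1) ++ y :: c2 -> r != z.
  move=> zs; apply: contraTneq us => ->.
  by rewrite cat_uniq /= zs /= !andbF.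
have rq : r != q by rewrite notr // !inE eqxx orbT.
have rp : r != last y c2 by rewrite notr // inE mem_cat mem_last !orbT.
rewrite /clos; have [//|epq] := boolP (e (last y c2) q).
rewrite eq_sym qp /=; rewrite esym in epq.
have := claw_heavy exq exr exp; rewrite eq_sym rq qp rp [e q r]esym erq erp epq.
move=> /(_ isT isT isT isT isT isT); rewrite (negbTE rl) orbF => ->; rewrite andbT.
have := claw_heavy exp exr exq; rewrite ![last y c2 == _]eq_sym rp qp rq.
rewrite [e (last _ _) r]esym [e (last _ _) q]esym erp erq epq.
by move=> /(_ isT isT isT isT isT isT); rewrite (negbTE rl) orbF.
Qed.

(** Otherwise run from [q] to the predecessor of [y], then through [x], [rho], [y] and [c2], and
    return to [q] by bypassing [x]. *)
Lemma detour_nadj_last x q c1 y c2 rho :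
  detour x (q :: c1) y c2 rho -> ~~ clos x (last q c1).
Proof.
move=> D; have cpq := detour_bypass D; move: D => [[cs nl _] us px rho0].
apply/negP=> cxl.
apply: (no_longer_insert nl us rho0 (s' := (q :: c1) ++ x :: rho ++ y :: c2)).
  by perm_count.
move: (sub_cycle sub_clos cs) (sub_path sub_clos px) cxl cpq; glue clos_sym.
Qed.

(** Induction along [d], from [p] to the next vertex [z]. If [r] were adjacent to [z], then [r]
    alone would be a detour to [z], against [detour_nadj_last]; if [x] were not, [r x p z] would be
    an induced path, forcing [p] and one of [x], [z] to be heavy. *)
Lemma detour_chain x q d d' y c2 r rho :
  detour x (q :: d ++ d') y c2 (r :: rho) ->
  path (fun p z => ~~ (heavy p && (heavy x || heavy z))) q d ->
  e x (last q d) && ~~ e r (last q d).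
Proof.
elim/last_ind: d d' => [|d z IH] d' D.
  by move=> _; rewrite (detour_next D) andbT; move: D => [[/= /andP[]]].
rewrite rcons_path => /andP[pd]; rewrite last_rcons.
set p := last q d => nstop.
have {}D : detour x (q :: d ++ z :: d') y c2 (r :: rho) by rewrite -cat_rcons.
have /andP[exp erp] := IH (z :: d') D pd.
have rl : ~~ heavy r by apply: (detour_light D); rewrite inE eqxx.
have exr : e x r by move: D => [_ _ /= /andP[]].
have epz : e p z.
  by move: D => [[+ _ _] _ _ _]; glue esym.
have erz : ~~ e r z.
  apply/negP=> erz.
  have /detour_nadj_last : detour x (q :: d) z (d' ++ y :: c2) [:: r].
    move: D => [[cs nl hs] us px _].
    have E : (q :: d ++ z :: d') ++ y :: c2 = (q :: d) ++ z :: d' ++ y :: c2.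
      by rewrite /= -catA.
    rewrite /detour -E; split => //=; last by rewrite exr erz.
    exact: uniq_cat1 us.
  by rewrite /clos -/p exp.
rewrite erz andbT; apply: contraR nstop => exz.
have := P4_heavy (a := r) (b := x) (c := p) (d := z); rewrite esym exr exp epz.
by rewrite erp exz erz (negbTE rl) => /(_ isT isT isT isT isT isT).
Qed.

(* Bypass [x] and [y], and insert them with [rho] just before the first heavy vertex
   that follows [y]; the light vertices in between are adjacent to [y]. *)
Lemma detour_heavy x c1 y c2 rho : heavy x -> ~ detour x c1 y c2 rho.
Proof.
move=> hx D; have Ds := detour_sym D.
case: c1 D Ds => [|q1 c1] D Ds; first exact: (detour_gap D).
case: c2 D Ds => [|q2 c2] D Ds; first exact: (detour_gap Ds).
have cy := detour_bypass Ds; have cx := detour_bypass D.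
have nyl := detour_nadj_last Ds.
(* On the reversed cycle [q2] comes just before [y], where the closure has no edge from [x]. *)
have lq2 : ~~ heavy q2.
  apply/negP=> hq2; have := detour_rev D; rewrite rev_cons.
  case E : (rcons _ _) => [|z s]; first by case: (rev c2) E.
  move/detour_nadj_last; rewrite -(last_cons x) -E last_rcons clos_heavy //.
  move: D => [_ + _ _]; rewrite cat_uniq /= => /andP[/andP[+ _] _].
  by apply: contraNneq => ->; rewrite !inE mem_cat !inE eqxx !orbT.
have [r [rho' Er]] : exists r rho', rev rho = r :: rho'.
  by case: (rev rho) Ds => [|r rho']; [case | exists r, rho'].
have chain d d' : c2 = d ++ d' -> all (predC heavy) d -> e y (last q2 d).
  move=> Ec ad; move: Ds; rewrite Er Ec => /detour_chain H.
  have /H/andP[] // : path (fun p z => ~~ (heavy p && (heavy y || heavy z))) q2 d.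
  apply: (path_all_right (P := predC heavy)) => // u v /=.
  by move=> /negbTE ->.
have [al|[d3 [g [d4 [Ec a3 hg]]]]] := all_or_split heavy c2.
  by move: nyl; rewrite /clos (chain c2 [::]) ?cats0.
have eyl := chain _ _ Ec a3.
case: D => [[cs nl _] us px rho0].
have xg : x != g.
  move: us; rewrite Ec cat_uniq /= => /andP[/andP[+ _] _].
  by apply: contraNneq => ->; rewrite !(inE, mem_cat) eqxx !orbT.
apply: (no_longer_insert nl us rho0
  (s' := (q1 :: c1) ++ (q2 :: d3) ++ y :: rev rho ++ x :: g :: d4)).
  by rewrite Ec; perm_count.
have py : path clos y (rcons (rev rho) x).
  by case: Ds => _ _ + _; apply: sub_path sub_clos _ _.
move: (sub_cycle sub_clos cs) py cx cy (sub_clos eyl) (clos_heavy xg hx hg).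
rewrite Ec; glue clos_sym.
Qed.

(* When [x] and [y] are light, they are adjacent to the first ends of heavy-heavy
   edges of [c1] and [c2]; the new cycle exchanges these two edges. *)
Lemma no_detour x c1 y c2 rho : ~ detour x c1 y c2 rho.
Proof.
move=> D; have Ds := detour_sym D.
have [hx|lx] := boolP (heavy x); first exact: detour_heavy hx D.
have [hy|ly] := boolP (heavy y); first exact: detour_heavy hy Ds.
case: c1 D Ds => [|q1 c1] D Ds; first exact: (detour_gap D).
case: c2 D Ds => [|q2 c2] D Ds; first exact: (detour_gap Ds).
have cy := detour_bypass Ds; have cx := detour_bypass D.
pose R p z := ~~ (heavy p && heavy z).
have chain x' q c y' c' rho' : ~~ heavy x' -> detour x' (q :: c) y' c' rho' ->
    exists d g d', [/\ c = d ++ g :: d', heavy (last q d) && heavy g & e x' (last q d)].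
  move=> lx' D'; have nl := detour_nadj_last D'.
  case: rho' D' => [|r rho'] D'; first by case: D'.
  have sub : subrel R (fun p z => ~~ (heavy p && (heavy x' || heavy z))).
    by move=> u v; rewrite /R (negbTE lx').
  have [pR|[d [g [d' [Ec pR /negPn hh]]]]] := path_or_split R q c.
    rewrite -[c]cats0 in D'; have /andP[] := detour_chain D' (sub_path sub pR).
    by move=> /sub_clos; rewrite (negbTE nl).
  exists d, g, d'; split=> //; rewrite Ec in D'.
  by have /andP[] := detour_chain D' (sub_path sub pR).
have [d1 [g1 [d2 [E1 /andP[hp1 hg1] exp1]]]] := chain _ _ _ _ _ _ lx D.
have [d3 [g2 [d4 [E2 /andP[hp2 hg2] eyp2]]]] := chain _ _ _ _ _ _ ly Ds.
case: D => [[cs nl _] us px rho0].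
have gg : g1 != g2.
  move: us; rewrite E1 E2 cat_uniq /= => /andP[/and3P[_ _ +] _].
  rewrite -!catA cat_uniq => /and3P[_ _ /= /andP[+ _]].
  by apply: contraNneq => ->; rewrite !(inE, mem_cat) eqxx !orbT.
(* After [y] the cycle runs back to [q2], bypasses [y] to the end of [d2], runs back to [g1],
   crosses to [g2] by a heavy pair, and bypasses [x] at the end. *)
apply: (no_longer_insert nl us rho0
  (s' := (q1 :: d1) ++ x :: rho ++ y :: rev (q2 :: d3) ++ rev (g1 :: d2) ++ g2 :: d4)).
  by rewrite E1 E2; perm_count.
move: (sub_cycle sub_clos cs) (sub_path sub_clos px) cx cy (sub_clos exp1).
move: (sub_clos eyp2) (clos_heavy gg hg1 hg2).
rewrite E1 E2; glue clos_sym.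
Qed.

End Heavy.

(** * Counting the added edges of a closure cycle *)

Section NonEdges.
Variables (T : finType) (e : rel T).
Hypotheses (esym : symmetric e).

(** On a walk of the closure, the counted steps are exactly those using added edges. *)
Definition path_defect x s := count negb (pairmap e x s).
Definition cycle_defect s := if s is x :: p then path_defect x (rcons p x) else 0.

Lemma path_defect_cat x s1 s2 :
  path_defect x (s1 ++ s2) = path_defect x s1 + path_defect (last x s1) s2.
Proof. by rewrite /path_defect pairmap_cat count_cat. Qed.

Lemma path_defect_rev z x s :
  path_defect z (rev (x :: s)) = ~~ e z (last x s) + path_defect x s.
Proof.
elim: s x z => [|y s IH] x z //=.
rewrite rev_cons -cats1 path_defect_cat IH last_rev_cons /path_defect /=. rewrite [e y x]esym. slia.
Qed.

Lemma cycle_defect_catC s1 s2 : cycle_defect (s1 ++ s2) = cycle_defect (s2 ++ s1).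
Proof.
case: s1 s2 => [|x s1] [|y s2] //=; rewrite ?cats0 //.
rewrite -!cats1 !(path_defect_cat, last_cat) /path_defect /=.
slia.
Qed.

End NonEdges.

(** * Hamiltonicity *)

Section Hamiltonian.
Variables (T : finType) (e : rel T).
Hypotheses (esym : symmetric e) (eirr : irreflexive e).
Local Notation heavy := (heavy e).
Local Notation clos := (clos e).

(* Ore's crossing argument at a non-edge of the cycle; a common neighbour of its
   ends outside the cycle would give a longer cycle. *)
Lemma reduce_defect s :
  cycle clos s -> uniq s -> no_longer e s -> ~~ cycle e s ->
  exists s', [/\ perm_eq s' s, cycle clos s' & cycle_defect e s' < cycle_defect e s].
Proof.
move=> cs us nl ncs.
have [x [c [ps Ed cc nlx]]] : exists x c, [/\ perm_eq (x :: c) s,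
    cycle_defect e (x :: c) = cycle_defect e s, cycle clos (x :: c) & ~~ e (last x c) x].
  case: s ncs cs {us nl} => [//|z p]; rewrite {1}/cycle.
  case: (path_or_split e z (rcons p z)) => [-> //|[s1 [x [s2 [E _ ns]]]]] _ cs.
  case/lastP: s2 E => [|s2 z'] E.
    move: E; rewrite cats1 => /rcons_inj[Ep Ez]; exists z, p; split=> //.
    by rewrite Ep {2}Ez.
  have [Ep Ez] : p = s1 ++ x :: s2 /\ z = z'.
    by move: E; rewrite -cats1 -rcons_cons -!cats1 catA !cats1 => /rcons_inj[-> ->].
  exists x, (s2 ++ z :: s1); split.
  - by rewrite Ep; perm_count.
  - by rewrite -cat_cons cycle_defect_catC Ep.
  - by rewrite -cat_cons -rot_size_cat rot_cycle /= -Ep.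
  - by rewrite last_cat.
rewrite -Ed; clear Ed.
have {}us : uniq (x :: c) by rewrite (perm_uniq ps).
have {}nl : no_longer e (x :: c).
  by apply: no_longer_perm nl; rewrite perm_sym.
suff [s' [ps' ? ?]] : exists s', [/\ perm_eq s' (x :: c), cycle clos s'
    & cycle_defect e s' < cycle_defect e (x :: c)].
  by exists s'; split=> //; apply: perm_trans ps' ps.
clear s cs ncs ps; set y := last x c in nlx *.
have cyx : clos y x by move: cc; rewrite /= rcons_path => /andP[].
have [yx hy hx] : [/\ y != x, heavy y & heavy x].
  by move: cyx; rewrite /clos (negbTE nlx) => /and3P.
have := cycle_next us; rewrite /= rcons_path -/y => /andP[pnext /eqP ynext].
pose N z := [set t | e z t].
(* [prev] fixes the vertices outside the cycle, so a common element is either a neighbour of [y]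
   preceding a neighbour [u] of [x], or a common neighbour off the cycle. *)
have [|||w wA wB] := @pigeonhole2 T (prev (x :: c) @: N x) (N y) [set~ y].
- apply/subsetP=> z /imsetP[u]; rewrite !inE => exu ->.
  apply: contraTneq exu => uy; rewrite -[u](next_prev us) uy.
  by rewrite -/(next (x :: c) y) ynext eirr.
- by apply/subsetP=> z; rewrite !inE; apply: contraTneq => ->; rewrite eirr.
- rewrite (card_imset _ (can_inj (next_prev us))) cardsC1.
  by move: hx hy; rewrite /heavy /deg -/(N x) -/(N y); slia.
case/imsetP: wA wB => u; rewrite !inE => exu -> {w}.
have [us_|nus] := boolP (u \in x :: c); last first.
  rewrite prev_nth (negbTE nus) => eyu.
  exfalso; apply: (no_longer_insert nl (rho := [:: u]) (s' := u :: x :: c)) => //.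
  - by rewrite cats1 rcons_uniq nus.
  - by perm_count.
  move: cc (sub_clos exu) (sub_clos eyu); rewrite /y; glue (clos_sym esym).
move: us_; rewrite inE => /predU1P[ux|]; first by move: exu; rewrite ux eirr.
move=> uc; have [d1 [d2 Ec]] : exists d1 d2, c = d1 ++ u :: d2.
  by case/splitPr: uc => d1 d2; exists d1, d2.
subst c; clear uc.
have -> : prev (x :: d1 ++ u :: d2) u = last x d1.
  move: pnext; rewrite cat_path /= => /and3P[_ /eqP E _].
  by rewrite -[RHS](prev_next us) -[next _ _]/(next_at (last x d1) x x (d1 ++ u :: d2)) E.
(* The non-edge at [y], [x] and the step into [u] are exchanged for two edges of [e]. *)
rewrite esym => eyw; exists (x :: d1 ++ rev (u :: d2)); split.
- by perm_count.
- move: cc (sub_clos exu) (sub_clos eyw); rewrite /y; glue (clos_sym esym).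
rewrite /cycle_defect !rcons_cat !path_defect_cat -cats1 path_defect_cat.
rewrite path_defect_rev // last_rev_cons.
move: nlx eyw; rewrite /y last_cat /= => nlx ->.
rewrite /path_defect /= -cats1 pairmap_cat count_cat /= nlx [e u x]esym exu; lia.
Qed.

Hypothesis claw_heavy : forall x a b c,
  e x a -> e x b -> e x c -> a != b -> a != c -> b != c ->
  ~~ e a b -> ~~ e a c -> ~~ e b c -> heavy a || heavy b.
Hypothesis P4_heavy : forall a b c d,
  e a b -> e b c -> e c d -> ~~ e a c -> ~~ e b d -> ~~ e a d ->
  (heavy a || heavy c) && (heavy b || heavy d).
Hypothesis conn1 : forall v, connected_on e [set~ v].

(* The starting cycle may be the degenerate [:: x; y] on two heavy vertices. *)
Lemma hamiltonian_of_closure s :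
  cycle clos s -> uniq s -> 1 < size s -> (forall h, heavy h -> h \in s) ->
  exists s', ucycle e s' /\ size s' = #|T|.
Proof.
move=> cs us szs hs.
suff /existsP[t ct] : [exists t : #|T|.-tuple T, ucycleb e t].
  by exists t; rewrite size_tuple.
(* The outer induction is on the number of missed vertices, the inner one on the number of added
   edges; this makes [s] extremal. *)
move En : (#|T| - size s) => m.
elim/ltn_ind: m s cs us szs hs En => m IHm s cs us szs hs En.
move Eb : (cycle_defect e s) => b.
elim/ltn_ind: b s Eb cs us szs hs En => b IHb s Eb cs us szs hs En.
apply: contraT => nham; exfalso.
have nl : no_longer e s.
  move=> s' us' ss sz' cs'; move/negP: nham; apply.
  have le' : size s' <= #|T| by rewrite -(card_uniqP us') max_card.
  apply: (IHm (#|T| - size s') _ s') => //; try by move=> h /hs /ss.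
    by slia.
  by slia.
have [ces|nces] := boolP (cycle e s); last first.
  have [s' [ps cs' lt']] := reduce_defect cs us nl nces.
  move/negP: nham; apply; apply: (IHb (cycle_defect e s') _ s') => //.
  - by rewrite -Eb.
  - by rewrite (perm_uniq ps).
  - by rewrite (perm_size ps).
  - by move=> h /hs; rewrite (perm_mem ps).
  - by rewrite (perm_size ps).
have [r rs|all_s] := pickP [predC s]; last first.
  have sz : size s == #|T|.
    rewrite -(card_uniqP us); apply/eqP/eq_card => z.
    by rewrite [RHS]inE; have /negbFE := all_s z.
  by move/negP: nham; apply; apply/existsP; exists (Tuple sz); rewrite /ucycleb ces.
have [a [b' [as_ bs ab]]] : exists a b', [/\ a \in s, b' \in s & a != b'].
  case: s us szs {IHb Eb cs hs En nl ces rs} => [|a [|b' s]] //= /andP[ab _] _.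
  exists a, b'; rewrite !inE !eqxx orbT; split=> //.
  by apply: contraNneq ab => ->; rewrite inE eqxx.
have [x [y [rho [[xs ys xy] [px rho0 /andP[ur /allP rs']]]]]] :=
  two_attachments esym conn1 as_ bs ab rs.
have [i c Er] := rot_to xs.
have yc : y \in c.
  by move: ys; rewrite -(mem_rot i) Er inE eq_sym (negbTE xy).
case/splitPr: yc Er => c1 c2 Er.
have ps : perm_eq s (x :: c1 ++ y :: c2) by rewrite -Er perm_sym perm_rot.
apply: (no_detour esym claw_heavy P4_heavy (x := x) (c1 := c1) (y := y) (c2 := c2)
  (rho := rho)); split=> //.
  split; first by rewrite -Er rot_cycle.
    exact: no_longer_perm ps nl.
  by move=> h /hs; rewrite (perm_mem ps).
rewrite cat_uniq ur andbT -Er rot_uniq us /=; apply/hasPn => z /rs'.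
by rewrite /= mem_rot.
Qed.

End Hamiltonian.

(** * Light vertices *)

Lemma is_cycle_graph4 (T : finType) (e : rel T) a b c d :
  symmetric e -> irreflexive e -> #|T| = 4 -> uniq [:: a; b; c; d] ->
  e a b -> e b c -> e c d -> e d a -> ~~ e a c -> ~~ e b d -> is_cycle_graph e.
Proof.
move=> es ei T4 us eab ebc ecd eda eac ebd; split; first by rewrite T4.
pose s := [:: a; b; c; d].
have [x xs|sx] := pickP [predC s]; first last.
  suff : graph_iso e (@cycle_rel 4) by rewrite T4.
  have ls x : index x s < 4 by rewrite -[4]/(size s) index_mem; have /negbFE := sx x.
  pose f x : 'I_4 := Ordinal (ls x).
  have nf x : nth a s (f x) = x by rewrite nth_index //; have /negbFE := sx x.
  exists f; split.
    apply: inj_card_bij; last by rewrite card_ord T4.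
    by move=> x y fxy; rewrite -[x]nf -[y]nf fxy.
  move=> x y; rewrite -{2}[x]nf -{2}[y]nf.
  case: (f x) => [[|[|[|[|?]]]] ?] //; case: (f y) => [[|[|[|[|?]]]] ?] //=;
    by rewrite /cycle_rel /= ?ei ?eab ?ebc ?ecd ?eda ?(negbTE eac) ?(negbTE ebd)
      // es ?eab ?ebc ?ecd ?eda ?(negbTE eac) ?(negbTE ebd).
have : size (x :: s) <= #|T|.
  rewrite -(card_uniqP _) ?max_card //= .
  by move: us xs => /= -> ->.
by rewrite T4.
Qed.

Section LightVertices.
Variables (T : finType) (e : rel T).
Hypotheses (esym : symmetric e) (eirr : irreflexive e).
Local Notation heavy := (heavy e).
Hypothesis claw_heavy : forall x a b c,
  e x a -> e x b -> e x c -> a != b -> a != c -> b != c ->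
  ~~ e a b -> ~~ e a c -> ~~ e b c -> heavy a || heavy b.
Hypothesis P4_heavy : forall a b c d,
  e a b -> e b c -> e c d -> ~~ e a c -> ~~ e b d -> ~~ e a d ->
  (heavy a || heavy c) && (heavy b || heavy d).
Hypothesis not_cycle : ~ is_cycle_graph e.

(** Take an edge [u v], not between heavy vertices, that leaves the dominated set. If [u] sees both
    [a] and [b], there is a claw with light leaves [a], [b]. If it sees only one, two induced paths
    ending in [w] and the other one force first the edge [u w], then [u] and [v] both heavy. *)
Lemma light_P3_dominating a w b :
  (forall x y, connect (fun u v => e u v && ~~ (heavy u && heavy v)) x y) ->
  ~~ heavy a -> ~~ heavy w -> ~~ heavy b -> e a w -> e w b -> a != b -> ~~ e a b ->
  forall z, [|| z == a, z == b, e a z | e b z].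
Proof.
move=> con la lw lb eaw ewb ab eab z; apply: contraT => nz.
pose P z := [|| z == a, z == b, e a z | e b z].
have Pa : P a by rewrite /P eqxx.
have [u [v [Pu nPv /andP[euv nh]]]] := connect_leave (con a z) Pa nz.
move: nPv; rewrite /P !negb_or => /and4P[va vb eav ebv].
have far w' : e a w' -> e b w' -> ~~ e w' v.
  move=> eaw' ebw'; apply/negP=> ew'v.
  have := @claw_heavy w' a b v; rewrite [e w' a]esym [e w' b]esym eaw' ebw' ew'v ab.
  rewrite ![_ == v]eq_sym va vb eab eav ebv (negbTE la) (negbTE lb).
  by move=> /(_ isT isT isT isT isT isT isT isT isT).
have side a' b' : ~~ heavy a' -> ~~ heavy b' -> e a' w -> e w b' -> ~~ e a' b' ->
    ~~ e b' v -> e a' u -> ~~ e b' u -> False.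
  move=> la' lb' ea'w ewb' ea'b' eb'v ea'u eb'u.
  have euw : e u w.
    apply: contraT => euw; have := @P4_heavy u a' w b'.
    rewrite esym ea'u ea'w ewb' euw ea'b' esym eb'u (negbTE la') (negbTE lb') andbF.
    by move=> /(_ isT isT isT isT isT isT).
  have := @P4_heavy v u w b'; rewrite esym euv euw ewb' [e v w]esym far //; last first.
    by rewrite esym.
  rewrite [e u b']esym eb'u [e v b']esym eb'v (negbTE lw) (negbTE lb') !orbF.
  by move=> /(_ isT isT isT isT isT isT) /andP[hv hu]; rewrite hu hv in nh.
move: Pu => /or4P[/eqP ua|/eqP ub|eau|ebu].
- by rewrite -ua euv in eav.
- by rewrite -ub euv in ebv.
- have [ebu|ebu] := boolP (e b u); first by have := far u eau ebu; rewrite euv.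
  by case: (side a b).
- have [eau|eau] := boolP (e a u); first by have := far u eau ebu; rewrite euv.
  by case: (side b a) => //; rewrite esym.
Qed.

(** Otherwise [a] and [b] dominate, and every vertex not adjacent to [w] is a common neighbour of
    both. The degree bounds then leave only the 4-cycle. *)
Lemma light_trans a w b :
  (forall x y, connect (fun u v => e u v && ~~ (heavy u && heavy v)) x y) ->
  ~~ heavy a -> ~~ heavy w -> ~~ heavy b -> e a w -> e w b -> a != b -> e a b.
Proof.
move=> con la lw lb eaw ewb ab; apply: contraT => eab.
have dom := light_P3_dominating con la lw lb eaw ewb ab eab.
exfalso; apply: not_cycle.
pose N z := [set y | e z y].
have ewN z : ~~ e w z -> z \in N a :&: N b.
  move=> ewz; rewrite !inE; have nab : (z != a) && (z != b).
    by apply/andP; split; apply: contraNneq ewz => -> //; rewrite esym.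
  have P4 a' b' : ~~ heavy a' -> ~~ heavy b' -> e a' w -> e w b' -> ~~ e a' b' ->
      e a' z -> e b' z.
    move=> la' lb' ea'w ewb' ea'b' ea'z; apply: contraT => eb'z.
    have := @P4_heavy z a' w b'; rewrite esym ea'z ea'w ewb' [e z w]esym ewz ea'b'.
    rewrite [e z b']esym eb'z (negbTE la') (negbTE lb') andbF.
    by move=> /(_ isT isT isT isT isT isT).
  have := dom z; case/andP: nab => /negbTE -> /negbTE -> /= /orP[eaz|ebz].
    by rewrite eaz (P4 a b).
  by rewrite ebz (P4 b a) // esym.
have cw : #|T| - deg e w <= #|N a :&: N b|.
  rewrite -[deg e w]/#|N w| -{1}(setCK (N w)) -cardsCs; apply: subset_leq_card; apply/subsetP=> z.
  by rewrite !in_setC in_set => /ewN.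
have cab : #|N a :|: N b| = #|T| - 2.
  have -> : N a :|: N b = ~: [set a; b].
    apply/setP=> z; rewrite !inE negb_or.
    apply/idP/idP => [|/andP[/negbTE za /negbTE zb]]; last by have := dom z; rewrite za zb.
    move=> H; apply/andP; split; apply: contraTneq H => ->; rewrite eirr.
      by rewrite esym (negbTE eab).
    by rewrite (negbTE eab).
  by rewrite cardsCs setCK cards2 ab.
have := cardsUI (N a) (N b); rewrite cab -/(deg e a) -/(deg e b) => sum.
have T3 : 2 < #|T|.
  have uw : uniq [:: a; w; b].
    rewrite /= !inE negb_or ab !andbT; apply/andP; split.
      by apply: contraTneq eaw => ->; rewrite eirr.
    by apply: contraTneq ewb => ->; rewrite eirr.
  by rewrite -[3]/(size [:: a; w; b]) -(card_uniqP uw) max_card.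
(* The three degrees sum to at least [2n - 2] and are each at most [n/2], so [n = 4] and all bounds
   are tight. *)
have [T4 M2 da dw] : [/\ #|T| = 4, #|N a :&: N b| = 2, deg e a = 2 & deg e w <= 2].
  move: la lw lb sum cw T3; rewrite /heavy -!leqNgt.
  by move: #|N a :&: N b| => m; split; slia.
have wM : w \in N a :&: N b by rewrite !inE eaw esym ewb.
have [w' w'M ww'] : exists2 w', w' \in N a :&: N b & w' != w.
  have : 0 < #|(N a :&: N b) :\ w| by move: M2; rewrite (cardsD1 w) wM; slia.
  by case/card_gt0P=> w'; rewrite !in_setD1 => /andP[ww' w'M]; exists w'.
have /setP Nw : N w = [set a; b].
  symmetry; apply/eqP; rewrite eqEcard cards2 ab dw andbT; apply/subsetP=> z.
  by rewrite !inE => /pred2P[] ->; rewrite // esym.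
move: w'M; rewrite !inE => /andP[eaw' ebw'].
have eww' : ~~ e w w'.
  have := Nw w'; rewrite !inE => ->; rewrite negb_or.
  by apply/andP; split; [apply: contraTneq eaw'|apply: contraTneq ebw'] => ->; rewrite eirr.
apply: (@is_cycle_graph4 T e a w b w') => //; last by rewrite esym.
rewrite /= !inE !negb_or ab [w == w']eq_sym ww' !andbT /= -!andbA; apply/and4P; split.
- by apply: contraTneq eaw => ->; rewrite eirr.
- by apply: contraTneq eaw' => ->; rewrite eirr.
- by apply: contraTneq ewb => ->; rewrite eirr.
- by apply: contraTneq ebw' => ->; rewrite eirr.
Qed.

Hypothesis conn : connected_on e setT.
Hypothesis conn1 : forall v, connected_on e [set~ v].
Hypothesis T3 : 2 < #|T|.

(** If at most [h] is heavy, the other vertices induce a connected graph with transitive adjacency,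
    hence a clique; a neighbour of [h] in it has degree [n - 1] and is heavy. *)
Lemma two_heavy : 1 < #|[set x | heavy x]|.
Proof.
rewrite ltnNge; apply/negP => le1.
have [h lh] : exists h, forall x, x != h -> ~~ heavy x.
  have [h hh|h0] := pickP heavy; last first.
    have /card_gt0P[h _] : 0 < #|T| by slia.
    by exists h => x _; rewrite h0.
  exists h => x xh; apply/negP=> hx.
  have : #|[set h; x]| <= #|[set x | heavy x]|.
    by apply: subset_leq_card; apply/subsetP=> z; rewrite !inE => /pred2P[] ->.
  by rewrite cards2 eq_sym xh => /leq_trans/(_ le1).
have con x y : connect (fun u v => e u v && ~~ (heavy u && heavy v)) x y.
  apply: connect_sub (conn (in_setT x) (in_setT y)) => u v /and3P[euv _ _].
  apply: connect1; rewrite euv /=; apply/negP => /andP[hu hv].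
  have uh : u = h by apply/eqP; apply: contraTT hu; apply: lh.
  have vh : v = h by apply/eqP; apply: contraTT hv; apply: lh.
  by rewrite uh vh eirr in euv.
have near x y : x != h -> y != h -> x != y -> e x y.
  move=> xh yh; have := @conn1 h x y; rewrite !inE => /(_ xh yh) /connectP[p].
  elim/last_ind: p y yh => [|p z IH] y yh; first by move=> _ ->; rewrite eqxx.
  rewrite rcons_path last_rcons => /andP[pp /and3P[elz + _]] yz; subst y; rewrite !inE => lh' xz.
  have [xl|xl] := eqVneq x (last x p); first by rewrite {1}xl.
  apply: (light_trans con _ _ _ (IH _ lh' pp erefl xl) elz) => //; exact: lh.
have [l lh' ehl] : exists2 l, l != h & e h l.
  have [z zh] : exists z, z != h.
    have : 0 < #|[set~ h]| by rewrite cardsC1; slia.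
    by case/card_gt0P=> z; rewrite !inE => zh; exists z.
  have := connect_leave (P := pred1 h) (conn (in_setT h) (in_setT z)).
  rewrite /= eqxx => /(_ isT zh) [u [l [/eqP -> ? /and3P[? _ _]]]].
  by exists l.
have /negP := lh l lh'; apply; rewrite /heavy.
have : #|[set~ l]| <= deg e l.
  apply: subset_leq_card; apply/subsetP=> z; rewrite !inE => zl.
  by have [->|zh] := eqVneq z h; rewrite 1?esym // near // eq_sym.
by rewrite cardsC1; slia.
Qed.

End LightVertices.

(** * Hamilton cycles of graphs that are not pancyclic *)

Section HamiltonCycle.
Variables (T : finType) (e : rel T).
Hypotheses (esym : symmetric e) (eirr : irreflexive e).
Local Notation heavy := (heavy e).
Hypothesis claw_heavy : forall x a b c,
  e x a -> e x b -> e x c -> a != b -> a != c -> b != c ->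
  ~~ e a b -> ~~ e a c -> ~~ e b c -> heavy a || heavy b.
Hypothesis P4_heavy : forall a b c d,
  e a b -> e b c -> e c d -> ~~ e a c -> ~~ e b d -> ~~ e a d ->
  (heavy a || heavy c) && (heavy b || heavy d).
Hypothesis not_cycle : ~ is_cycle_graph e.
Hypothesis not_pancyclic : ~ pancyclic e.

Definition hamiltonian_cycle s := [/\ cycle e s, uniq s & size s = #|T|].

Lemma hamiltonian_mem s x : hamiltonian_cycle s -> x \in s.
Proof.
case=> _ us szs; have sub : {subset s <= enum T} by move=> ?; rewrite mem_enum.
have [|_ /(_ x)] := uniq_min_size us sub; first by rewrite -cardE szs.
by rewrite mem_enum.
Qed.

Lemma hamiltonian_rot s1 s2 : hamiltonian_cycle (s1 ++ s2) -> hamiltonian_cycle (s2 ++ s1).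
Proof.
case=> cs us szs; split; first by rewrite -rot_size_cat rot_cycle.
  by rewrite uniq_catC.
by rewrite size_cat addnC -size_cat.
Qed.

Lemma hamiltonian_perm s s' :
  hamiltonian_cycle s -> perm_eq s' s -> cycle e s' -> hamiltonian_cycle s'.
Proof. by case=> _ us szs ps cs'; split; rewrite ?(perm_uniq ps) ?(perm_size ps). Qed.

Lemma not_consecutive_heavy x y c :
  hamiltonian_cycle (x :: y :: c) -> heavy x -> ~~ heavy y.
Proof.
move=> [cs us szs] hx; apply/negP=> hy; apply: not_pancyclic.
apply: (pancyclic_of_consecutive esym eirr _ szs); first by rewrite /ucycle cs.
by move: hx hy; rewrite /heavy; slia.
Qed.

(** The cycle [t] may visit the remaining vertices in any order, which allows segments to be
    rearranged. *)
Lemma not_bypassed_heavy h s t :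
  hamiltonian_cycle s -> perm_eq (h :: t) s -> heavy h -> ~~ cycle e t.
Proof.
move=> [cs us szs] pt hh; apply/negP=> ct; apply: not_pancyclic.
have : uniq (h :: t) by rewrite (perm_uniq pt).
move=> /= /andP[ht ut]; apply: (pancyclic_of_missed_vertex esym eirr ct ut ht).
  by rewrite -szs -(perm_size pt).
exact: ltnW.
Qed.

(** On light vertices this is an equivalence relation, by [same_clique_trans]; its classes are the
    light cliques. *)
Definition same_clique x y := (x == y) || e x y.

(** * Neighbours of a heavy vertex on a Hamilton cycle *)

Section AroundHeavy.
Variables (h b : T) (c : seq T).
Hypotheses (hamc : hamiltonian_cycle (h :: b :: c)) (hh : heavy h).
Let a := last b c.

Let hb : e h b. Proof. by case: hamc => /= /andP[]. Qed.

Let ah : e a h. Proof. by case: hamc; glue esym. Qed.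

Lemma light_next_heavy : ~~ heavy b.
Proof. exact: not_consecutive_heavy hamc hh. Qed.

Lemma light_prev_heavy : ~~ heavy a.
Proof.
have ham' : hamiltonian_cycle (a :: h :: belast b c).
  have := hamiltonian_rot (s1 := h :: belast b c) (s2 := [:: a]); apply.
  by rewrite cats1 rcons_cons -lastI.
by apply: contraL hh; apply: not_consecutive_heavy ham'.
Qed.

Lemma nadj_around_heavy : ~~ e a b.
Proof.
have := not_bypassed_heavy hamc (perm_refl _) hh; apply: contraNN => eab.
by case: hamc => + _ _; move: eab; rewrite /a; glue esym.
Qed.

Lemma neq_around_heavy : a != b.
Proof.
apply/eqP => ab; have [cs us szs] := hamc.
have c0 : c = [::].
  case E : c => [//|y c']; move: us ab; rewrite /a E /= => /and3P[_ /negP bc _] ab.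
  by case: bc; rewrite -ab mem_last.
have : deg e h <= #|[set~ h]|.
  apply: subset_leq_card; apply/subsetP=> z; rewrite !inE.
  by apply: contraTneq => ->; rewrite eirr.
by move: hh; rewrite cardsC1 /heavy -szs c0 /=; slia.
Qed.

(** Otherwise [h] is the centre of a claw with the light leaves [a], [b], [l]. *)
Lemma light_nbr_heavy l :
  ~~ heavy l -> e h l -> same_clique a l || same_clique b l.
Proof.
move=> ll ehl; rewrite /same_clique; apply: contraT; rewrite !negb_or.
move=> /andP[/andP[al eal] /andP[bl ebl]].
have := @claw_heavy h a b l; rewrite esym ah hb ehl neq_around_heavy al bl nadj_around_heavy.
rewrite eal ebl (negbTE light_prev_heavy) (negbTE light_next_heavy).
by move=> /(_ isT isT isT isT isT isT isT isT isT).
Qed.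

Lemma heavy_nbr_heavy x : heavy x -> e h x -> e x a || e x b.
Proof.
move=> hx ehx; apply: contraT; rewrite negb_or => /andP[exa exb].
have ne z : ~~ heavy z -> z != x by apply: contraNneq => ->.
have := @claw_heavy h a b x; rewrite esym ah hb ehx neq_around_heavy nadj_around_heavy.
rewrite !ne ?light_prev_heavy ?light_next_heavy // [e a x]esym [e b x]esym exa exb.
rewrite (negbTE light_prev_heavy) (negbTE light_next_heavy).
by move=> /(_ isT isT isT isT isT isT isT isT isT).
Qed.

(** The Hamilton cycle itself has no two consecutive heavy vertices; this makes [light_trans]
    applicable. *)
Lemma connect_light_edges x y :
  connect (fun u v => e u v && ~~ (heavy u && heavy v)) x y.
Proof.
pose g u v := e u v && ~~ (heavy u && heavy v).
have gc : cycle g (h :: b :: c).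
  have [cs us szs] := hamc; apply: cycle_from_next => // z zs.
  rewrite /g next_cycle // andTb; apply/negP => /andP[hz hnz].
  have [i s' Er] := rot_to zs.
  have ham' : hamiltonian_cycle (z :: s').
    by rewrite -Er; apply: hamiltonian_rot; rewrite cat_take_drop.
  case: s' Er ham' => [|w s'] Er ham'.
    by case: ham' => _ _ /=; rewrite -szs.
  have := not_consecutive_heavy ham' hz; rewrite -(next_rot i us) Er /= eqxx in hnz.
  by rewrite hnz.
have gsym : connect_sym g.
  by apply: sym_connect_sym => u v; rewrite /g esym [heavy u && _]andbC.
have from_h z : connect g h z.
  by apply: (path_connect gc); rewrite inE mem_rcons (hamiltonian_mem z hamc) orbT.
by apply: (connect_trans (y := h)); rewrite ?from_h // gsym.
Qed.

Lemma same_clique_trans x y z : ~~ heavy x -> ~~ heavy y -> ~~ heavy z ->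
  same_clique x y -> same_clique y z -> same_clique x z.
Proof.
move=> lx ly lz /orP[/eqP -> //|exy] /orP[/eqP <-|eyz].
  by rewrite /same_clique exy orbT.
rewrite /same_clique; case: eqVneq => //= xz.
exact: (light_trans esym eirr claw_heavy P4_heavy not_cycle connect_light_edges lx ly lz).
Qed.

(** Say [l] is in the clique of [x], one of [a] and [b], and [y] is the other. If [h] missed [l],
    then [l x h y] would be an induced path with [x] and [y] light. *)
Lemma heavy_adj_light l :
  ~~ heavy l -> same_clique a l || same_clique b l -> e h l.
Proof.
have sep x y : ~~ heavy x -> ~~ heavy y -> ~~ heavy l -> x != y -> ~~ e x y ->
    e h x -> e h y -> same_clique x l -> e h l.
  move=> lx ly ll xy exy ehx ehy /orP[/eqP <- //|exl].
  have eyl : ~~ e y l.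
    apply: contraNN exy => eyl; move: xy.
    have : same_clique x y.
      by apply: (@same_clique_trans x l y) => //; rewrite /same_clique ?exl 1?esym ?eyl orbT.
    by rewrite /same_clique => /orP[->|].
  apply: contraT => ehl; have := @P4_heavy l x h y.
  rewrite esym exl [e x h]esym ehx ehy [e l h]esym ehl exy [e l y]esym eyl.
  rewrite (negbTE lx) (negbTE ly) andbF.
  by move=> /(_ isT isT isT isT isT isT).
move=> ll /orP[]; [apply: (sep a b) | apply: (sep b a)] => //;
  rewrite ?light_prev_heavy ?light_next_heavy ?nadj_around_heavy ?neq_around_heavy //.
- by rewrite esym.
- by rewrite eq_sym neq_around_heavy.
- by rewrite esym nadj_around_heavy.
- by rewrite esym.
Qed.

End AroundHeavy.

Lemma same_clique_sym x y : same_clique x y = same_clique y x.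
Proof. by rewrite /same_clique eq_sym esym. Qed.


Lemma heavy_adj_prev h t y l :
  hamiltonian_cycle (h :: rcons t y) -> heavy h -> ~~ heavy l -> same_clique y l -> e h l.
Proof.
move=> hamc hh ll yl; case: t hamc => [|b t] hamc; apply: (heavy_adj_light hamc) => //=.
  by rewrite yl.
by rewrite last_rcons yl.
Qed.

(** * Light segments between heavy vertices *)

Section Blocks.
Hypothesis clique_trans : forall x y z, ~~ heavy x -> ~~ heavy y -> ~~ heavy z ->
  same_clique x y -> same_clique y z -> same_clique x z.

Lemma light_path_clique b s : path e b s -> all (predC heavy) (b :: s) ->
  {in b :: s &, forall x y, same_clique x y}.
Proof.
move=> pb ls.
have cl x : x \in b :: s -> same_clique b x.
  elim: s b pb ls => [|z s IH] b /=.
    by rewrite inE => _ _ /eqP ->; rewrite /same_clique eqxx.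
  move=> /andP[ebz pz] /and3P[lb lz ls] /predU1P[->|xs]; first by rewrite /same_clique eqxx.
  apply: (@clique_trans b z x) => //; last by apply: IH; rewrite //= lz.
    by case/predU1P: xs => [-> //|/(allP ls)].
  by rewrite /same_clique ebz orbT.
move=> x y xs ys; apply: (@clique_trans x b y); rewrite ?(allP ls _ _) ?cl //.
- exact: (allP ls x xs).
- by move: ls => /andP[].
- exact: (allP ls y ys).
- by rewrite same_clique_sym cl.
Qed.

Lemma block_nonempty h s g r : hamiltonian_cycle (h :: s ++ g :: r) ->
  heavy h -> heavy g -> exists b s', s = b :: s'.
Proof.
case: s => [|b s'] hamc hh hg; last by exists b, s'.
by have := not_consecutive_heavy hamc hh; rewrite hg.
Qed.

(** Let [z1] end [s]. If [h] and [g] are not adjacent, [h z1 g z] is not an induced path, so [h]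
    sees [z]. Then [z] is in the clique of a cycle neighbour of [h], and not in that of [s], since
    [z1] and [z] are the nonadjacent neighbours of [g]. *)
Lemma heavies_adj_or_return h s g z r : hamiltonian_cycle (h :: s ++ g :: z :: r) ->
  heavy h -> heavy g -> all (predC heavy) s -> e h g || same_clique z (last z r).
Proof.
move=> hamc hh hg; have [b [s' Es]] := block_nonempty hamc hh hg; subst s => ls.
pose z1 := last b s'.
have edges : [/\ path e b s', e z1 g & e g z].
  by case: hamc => + _ _; rewrite /z1; glue esym; split.
case: edges => pb ez1g egz.
have z1s : z1 \in b :: s' by exact: mem_last.
have lz1 : ~~ heavy z1 by exact: (allP ls _ z1s).
have clb := light_path_clique pb ls.
have hamg : hamiltonian_cycle (g :: z :: (r ++ h :: b :: s')).
  exact: (@hamiltonian_rot (h :: b :: s') (g :: z :: r)).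
have lz := light_next_heavy hamg hg.
have ehz1 : e h z1.
  by apply: (heavy_adj_light hamc hh lz1); rewrite (clb b) ?mem_head ?orbT.
have ez1z : ~~ e z1 z by have := nadj_around_heavy hamg hg; rewrite last_cat.
have z1z : z1 != z by have := neq_around_heavy hamg hg; rewrite last_cat.
apply: contraT; rewrite negb_or => /andP[ehg nret].
have ehz : e h z.
  apply: contraT => ehz; have := @P4_heavy h z1 g z.
  rewrite ehz1 ez1g egz ehg ez1z ehz (negbTE lz1) (negbTE lz) andbF.
  by move=> /(_ isT isT isT isT isT isT).
have := light_nbr_heavy hamc hh lz ehz; rewrite last_cat /= same_clique_sym (negbTE nret) /=.
move=> bz; have : same_clique z1 z.
  apply: (@clique_trans z1 b z) => //; first by case/andP: ls.
  by rewrite clb ?mem_head.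
by rewrite /same_clique (negbTE z1z) (negbTE ez1z).
Qed.

(* Each light clique is a single segment: otherwise the segment [s] could be moved
   next to [y], making [h] and [g] consecutive, or making [h] superfluous if they are
   not adjacent. *)
Lemma no_return h s g r : hamiltonian_cycle (h :: s ++ g :: r) ->
  heavy h -> heavy g -> all (predC heavy) s ->
  forall x y, x \in s -> y \in r -> ~~ heavy y -> ~~ same_clique x y.
Proof.
move=> hamc hh hg; have [b [s' Es]] := block_nonempty hamc hh hg; subst s => ls.
move=> x y xs yr ly; apply/negP => xy.
have pb : path e b s' by case: hamc => + _ _; glue esym.
have clb := light_path_clique pb ls.
have adj z : z \in b :: s' -> same_clique z y.
  move=> zs; apply: (@clique_trans z x y) => //; rewrite ?clb //.
    exact: (allP ls z zs).
  exact: (allP ls x xs).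
have disj z w : z \in b :: s' -> w \in r -> z != w.
  move=> zs wr; case: hamc => _ + _.
  rewrite cons_uniq cat_uniq => /andP[_ /and3P[_ /hasPn dis _]].
  by apply: contraTneq zs => ->; apply: dis; rewrite inE wr orbT.
have adjE z w : z \in b :: s' -> w \in r -> same_clique z w -> e z w.
  by move=> zs wr; rewrite /same_clique (negbTE (disj z w zs wr)).
have [r1 [r2 Er]] : exists r1 r2, r = r1 ++ y :: r2.
  by case/splitPr: yr => r1 r2; exists r1, r2.
have eyb : e y b by rewrite esym adjE ?adj ?mem_head.
case: r2 Er => [|z2 r2] Er.
  have := nadj_around_heavy hamc hh; rewrite last_cat /= Er last_cat /=.
  by rewrite eyb.
pose z1 := last b s'; have z1s : z1 \in b :: s' by exact: mem_last.
have z2r : z2 \in r by rewrite Er mem_cat !inE eqxx !orbT.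
(* [z2] follows [y], whose clique contains [z1]; if [z2] is heavy, it sees the light vertices of
   that clique. *)
have ez1z2 : e z1 z2.
  have [hz2|lz2] := boolP (heavy z2).
    rewrite esym; apply: (@heavy_adj_prev _ (r2 ++ h :: b :: s' ++ g :: r1) y) => //.
    - have -> : z2 :: rcons (r2 ++ h :: b :: s' ++ g :: r1) y =
          (z2 :: r2) ++ (h :: b :: s' ++ g :: r1) ++ [:: y] by rewrite -cats1 /= -catA.
      by apply: hamiltonian_rot; move: hamc; rewrite Er; repeat progress rewrite /= -?catA.
    - exact: (allP ls z1 z1s).
    - by rewrite same_clique_sym adj.
  apply: adjE => //; apply: (@clique_trans z1 y z2); rewrite ?adj //.
    exact: (allP ls z1 z1s).
  rewrite /same_clique; case: hamc => + _ _; rewrite Er; glue esym.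
  by rewrite orbC; apply/orP; left.
subst r; pose t := g :: r1 ++ y :: (b :: s') ++ z2 :: r2.
have pt : perm_eq (h :: t) (h :: (b :: s') ++ g :: r1 ++ y :: z2 :: r2).
  by rewrite /t; perm_count.
have [ehg|ehg] := boolP (e h g).
  suff : hamiltonian_cycle (h :: t) by move/not_consecutive_heavy/(_ hh); rewrite hg.
  apply: (hamiltonian_perm hamc pt).
  by case: hamc => + _ _; move: ehg eyb ez1z2; rewrite /t /z1; glue esym.
have /negP := not_bypassed_heavy hamc pt hh; apply.
(* The vertex after [g] shares the clique of the predecessor of [h], so [g] sees that predecessor
   and [t] closes up without [h]. *)
have ega : e g (last z2 r2).
  have [z [r' [Ez <-]]] : exists z r', r1 ++ y :: z2 :: r2 = z :: r' /\ last z r' = last z2 r2.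
    by case: (r1) => [|z r1']; [exists y, (z2 :: r2) | exists z, (r1' ++ y :: z2 :: r2);
      rewrite last_cat].
  move: hamc; rewrite Ez => hamc.
  have := heavies_adj_or_return hamc hh hg ls; rewrite (negbTE ehg) /= => ret.
  have := light_prev_heavy hamc hh; rewrite last_cat /= => la.
  have hamg := @hamiltonian_rot (h :: b :: s') (g :: z :: r') hamc.
  by apply: (heavy_adj_light hamg hg la); rewrite ret orbT.
by case: hamc => + _ _; move: ega eyb ez1z2; rewrite /t /z1; glue esym.
Qed.

(** All of [s] lies in the clique of the predecessor of [g], so one can jump to [g] from any vertex
    of [s]. *)
Lemma block_path h s g r i : hamiltonian_cycle (h :: s ++ g :: r) ->
  heavy h -> heavy g -> all (predC heavy) s -> (0 < i) || e h g ->
  path e h (rcons (take i s) g).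
Proof.
move=> hamc hh hg; have [b [s' Es]] := block_nonempty hamc hh hg; subst s => ls.
case: i => [|i] /= ehg; first by rewrite ehg.
have [ehb pb] : e h b /\ path e b s' by case: hamc => + _ _; glue esym.
have clb := light_path_clique pb ls.
have ts : {subset b :: take i s' <= b :: s'}.
  by move=> x; rewrite !inE => /orP[->//|/mem_take ->]; rewrite orbT.
rewrite ehb rcons_path /= esym; apply/andP; split.
  by move: pb; rewrite -{1}(cat_take_drop i s') cat_path => /andP[].
have ls' := ts _ (mem_last _ _).
apply: (@heavy_adj_prev g (r ++ h :: belast b s') (last b s')) => //.
- have := @hamiltonian_rot (h :: b :: s') (g :: r) hamc.
  by rewrite rcons_cat rcons_cons -lastI.
- exact: (allP ls _ ls').
- by rewrite clb // mem_last.
Qed.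

Lemma block_triangle h b z r : hamiltonian_cycle (h :: b :: z :: r) ->
  heavy h -> ~~ heavy z -> has_cycle_of_length e 3.
Proof.
move=> hamc hh lz; exists [:: h; b; z]; split=> //; case: (hamc) => cs us _.
have [ehb ebz] : e h b /\ e b z by move: cs; glue esym; split.
apply/andP; split; last exact: subseq_uniq (prefix_subseq [:: h; b; z] r) us.
rewrite /= ehb ebz esym (heavy_adj_light hamc hh lz) //.
by rewrite /same_clique ebz !orbT.
Qed.

(** Shortening both segments gives every length, except 3 when [h] and [g] are not adjacent; then a
    segment with two vertices gives a triangle. *)
Lemma two_blocks h s g s' : hamiltonian_cycle (h :: s ++ g :: s') ->
  heavy h -> heavy g -> all (predC heavy) s -> all (predC heavy) s' -> False.
Proof.
move=> hamc hh hg ls ls'; apply: not_pancyclic => k /andP[k3 kn].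
have hamg : hamiltonian_cycle (g :: s' ++ h :: s) by exact: (@hamiltonian_rot (h :: s) (g :: s')).
have [_ us szs] := hamc.
have two i j : i <= size s -> j <= size s' -> (0 < i) || e h g -> (0 < j) || e h g ->
    has_cycle_of_length e (i + j).+2.
  move=> les les' i0 j0; exists (h :: take i s ++ g :: take j s'); split.
    by rewrite /= size_cat /= !size_takel ?addnS.
  rewrite esym in j0.
  apply/andP; split.
    move: (block_path hamc hh hg ls i0) (block_path hamg hg hh ls' j0).
    by glue esym.
  apply: (@subseq_uniq _ _ (h :: s ++ g :: s')) us => /=; rewrite eqxx.
  by apply: cat_subseq; rewrite ?take_subseq //= eqxx take_subseq.
have n2 : #|T| = (size s + size s').+2 by rewrite -szs /= size_cat /= addnS.
have [ehg|ehg] := boolP (e h g).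
  have -> : k = (minn (size s) (k - 2) + (k - 2 - minn (size s) (k - 2))).+2 by slia.
  by apply: two; rewrite ?ehg ?orbT //; slia.
have [b [t Es]] := block_nonempty hamc hh hg.
have [b' [t' Es']] := block_nonempty hamg hg hh.
have s1 : 0 < size s by rewrite Es.
have s1' : 0 < size s' by rewrite Es'.
have [k4|k3'] := ltnP 3 k.
  (* Using [k - 3] rather than [k - 2] leaves a vertex for the second segment. *)
  have -> : k = (minn (size s) (k - 3) + (k - 2 - minn (size s) (k - 3))).+2 by slia.
  by apply: two; rewrite ?(negbTE ehg) ?orbF; slia.
have {k3 k3' kn} -> : k = 3 by slia.
case: t Es => [|z t] Es; last first.
  move: hamc ls; rewrite Es => hamc' /and3P[_ lz _].
  exact: (block_triangle (r := t ++ g :: s') hamc').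
case: t' Es' => [|z t'] Es'; last first.
  move: hamg ls'; rewrite Es' => hamg' /and3P[_ lz _].
  exact: (block_triangle (r := t' ++ h :: s) hamg').
(* With one vertex per segment [n = 4], and [h] has at most two neighbours, too few for a heavy
   vertex. *)
exfalso; have : deg e h <= #|~: [set h; g]|.
  apply: subset_leq_card; apply/subsetP=> x; rewrite !inE.
  by apply: contraTN => /pred2P[] ->; rewrite ?eirr.
have hg' : h != g by apply: contraTneq us => ->; rewrite /= mem_cat mem_head orbT.
rewrite cardsCs setCK cards2 hg' n2 Es Es' /=; move: hh.
by rewrite /heavy n2 Es Es' /=; slia.
Qed.

(** The alternative in [heavies_adj_or_return] would put vertices of [s1] and [s2] in one clique,
    against [no_return]. *)
Lemma three_blocks_adj h s g s1 k s2 :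
  hamiltonian_cycle (h :: s ++ g :: s1 ++ k :: s2) -> heavy h -> heavy g -> heavy k ->
  all (predC heavy) s -> all (predC heavy) s1 -> all (predC heavy) s2 -> e h g.
Proof.
move=> hamc hh hg hk ls ls1 ls2.
have hamg : hamiltonian_cycle (g :: s1 ++ k :: s2 ++ h :: s).
  have := @hamiltonian_rot (h :: s) (g :: s1 ++ k :: s2) hamc.
  by repeat progress rewrite /= -?catA.
have hamk : hamiltonian_cycle (k :: s2 ++ h :: s ++ g :: s1).
  have := @hamiltonian_rot (g :: s1) (k :: s2 ++ h :: s) hamg.
  by repeat progress rewrite /= -?catA.
have [z [t1 Es1]] := block_nonempty hamg hg hk; subst s1.
have [a [t2 Es2]] := block_nonempty hamk hk hh; subst s2.
have := heavies_adj_or_return hamc hh hg ls; rewrite last_cat /=.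
have /negbTE -> : ~~ same_clique z (last a t2); last by rewrite orbF.
apply: (no_return hamg hg hk ls1 (mem_head z t1)); first by rewrite mem_cat mem_last.
exact: (allP ls2 _ (mem_last a t2)).
Qed.

Lemma three_blocks h s g s1 k s2 :
  hamiltonian_cycle (h :: s ++ g :: s1 ++ k :: s2) -> heavy h -> heavy g -> heavy k ->
  all (predC heavy) s -> all (predC heavy) s1 -> all (predC heavy) s2 -> False.
Proof.
move=> hamc hh hg hk ls ls1 ls2; apply: not_pancyclic => l /andP[l3 ln].
have hamg : hamiltonian_cycle (g :: s1 ++ k :: s2 ++ h :: s).
  have := @hamiltonian_rot (h :: s) (g :: s1 ++ k :: s2) hamc.
  by repeat progress rewrite /= -?catA.
have hamk : hamiltonian_cycle (k :: s2 ++ h :: s ++ g :: s1).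
  have := @hamiltonian_rot (g :: s1) (k :: s2 ++ h :: s) hamg.
  by repeat progress rewrite /= -?catA.
have ehg := three_blocks_adj hamc hh hg hk ls ls1 ls2.
have egk := three_blocks_adj hamg hg hk hh ls1 ls2 ls.
have ekh := three_blocks_adj hamk hk hh hg ls2 ls ls1.
have [_ us szs] := hamc.
have ntot : #|T| = (size s + size s1 + size s2).+3.
  by rewrite -szs /= !size_cat /= !size_cat /=; slia.
(* The [l - 3] light vertices are taken greedily from the three segments; the heavy vertices are
   pairwise adjacent, so empty pieces are allowed. *)
pose i := minn (size s) (l - 3); pose i1 := minn (size s1) (l - 3 - i).
pose i2 := l - 3 - i - i1.
have [li li1 li2] : [/\ i <= size s, i1 <= size s1 & i2 <= size s2].
  by rewrite /i2 /i1 /i; split; slia.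
exists (h :: take i s ++ g :: take i1 s1 ++ k :: take i2 s2); split.
  rewrite /= !size_cat /= !size_cat /= !size_takel //.
  by rewrite /i2 /i1 /i; slia.
apply/andP; split.
  have := block_path hamc hh hg ls (i := i); rewrite ehg orbT => /(_ isT).
  have := block_path hamg hg hk ls1 (i := i1); rewrite egk orbT => /(_ isT).
  have := block_path hamk hk hh ls2 (i := i2); rewrite ekh orbT => /(_ isT).
  by glue esym.
apply: (@subseq_uniq _ _ (h :: s ++ g :: s1 ++ k :: s2)) us => /=; rewrite eqxx.
apply: cat_subseq; rewrite ?take_subseq //= eqxx.
by apply: cat_subseq; rewrite ?take_subseq //= eqxx take_subseq.
Qed.

(** [g] and [p] are the heavy vertices next to [h], and [m] is everything strictly between them on
    the far side, including [k]; [q] may contain further heavy vertices. *)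
Lemma four_blocks h s g s1 k q p s0 :
  hamiltonian_cycle (h :: s ++ g :: s1 ++ k :: q ++ p :: s0) ->
  heavy h -> heavy g -> heavy k -> heavy p ->
  all (predC heavy) s -> all (predC heavy) s1 -> all (predC heavy) s0 -> False.
Proof.
move=> hamc hh hg hk hp ls ls1 ls0.
have [m Em] : exists m, m = s1 ++ k :: q by exists (s1 ++ k :: q).
have {}hamc : hamiltonian_cycle (h :: s ++ g :: m ++ p :: s0).
  by move: hamc; rewrite Em -catA.
have hamg : hamiltonian_cycle (g :: s1 ++ k :: q ++ p :: s0 ++ h :: s).
  have := @hamiltonian_rot (h :: s) (g :: m ++ p :: s0) hamc.
  by rewrite Em; repeat progress rewrite /= -?catA.
have hamp : hamiltonian_cycle (p :: s0 ++ h :: s ++ g :: m).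
  have := @hamiltonian_rot (h :: s ++ g :: m) (p :: s0).
  by repeat progress rewrite /= -?catA; apply.
have [b [t Es]] := block_nonempty hamc hh hg.
have [a [t0 Es0]] := block_nonempty hamp hp hh.
have [z1 [t1 Es1]] := block_nonempty hamg hg hk.
have far_s x y : x \in s -> y \in m -> ~~ heavy y -> ~~ same_clique x y.
  by move=> xs ym ly; apply: (no_return hamc) => //; rewrite mem_cat ym.
have far_s0 x y : x \in s0 -> y \in m -> ~~ heavy y -> ~~ same_clique x y.
  move=> xs ym ly; apply: (no_return hamp) => //.
  by rewrite !(mem_cat, inE) ym !orbT.
(* Light neighbours of [x] are in the cliques of its two cycle neighbours, which belong to [m]. *)
have heavy_far x l : heavy x -> x \in m -> l \in s ++ s0 -> ~~ e x l.
  move=> hx xm ls'; apply/negP => exl.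
  have [m1 [m2 E]] : exists m1 m2, m = m1 ++ x :: m2.
    by case/splitPr: xm => m1 m2; exists m1, m2.
  have hamx : hamiltonian_cycle (x :: m2 ++ p :: s0 ++ h :: s ++ g :: m1).
    have := @hamiltonian_rot (h :: s ++ g :: m1) (x :: m2 ++ p :: s0).
    rewrite E in hamc; repeat progress rewrite /= -?catA; apply.
    by move: hamc; repeat progress rewrite /= -?catA.
  case: m2 E hamx => [|w m2] E hamx.
    by have := not_consecutive_heavy hamx hx; rewrite hp.
  case/lastP: m1 E hamx => [|m1 w'] E hamx.
    by move: E ls1; rewrite Em Es1 /= => -[-> _]; rewrite hx.
  have ll : ~~ heavy l.
    by move: ls'; rewrite mem_cat => /orP[/(allP ls)|/(allP ls0)].
  have lw := light_next_heavy hamx hx.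
  have := light_prev_heavy hamx hx; have := light_nbr_heavy hamx hx ll exl.
  rewrite !last_cat /= !last_cat /= last_cat /= last_rcons => cl lw'.
  have wm : w \in m by rewrite E mem_cat !inE eqxx !orbT.
  have w'm : w' \in m by rewrite E mem_cat mem_rcons mem_head.
  have far y : y \in m -> ~~ heavy y -> ~~ same_clique y l.
    move=> ym ly; rewrite same_clique_sym.
    by move: ls'; rewrite mem_cat => /orP[xs|xs]; [apply: far_s | apply: far_s0].
  by move: cl; rewrite (negbTE (far w' w'm lw')) (negbTE (far w wm lw)).
have as0 : last a t0 \in s0 by rewrite Es0 mem_last.
have bs : b \in s by rewrite Es mem_head.
(* A heavy neighbour of [h] would see [b] or [last a t0], a light one would be in the clique of one
   of them. *)
have h_far x : x \in m -> ~~ e h x.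
  move=> xm; apply/negP => ehx; rewrite Es Es0 in hamc.
  have [hx|lx] := boolP (heavy x).
    have := heavy_nbr_heavy hamc hh hx ehx; rewrite !last_cat /= !last_cat /= => xab.
    have := heavy_far x (last a t0) hx xm; have := heavy_far x b hx xm.
    by rewrite !mem_cat as0 bs orbT; case/orP: xab => -> => [_ /(_ isT)|/(_ isT)].
  have := light_nbr_heavy hamc hh lx ehx; rewrite !last_cat /= !last_cat /=.
  by rewrite (negbTE (far_s0 _ _ as0 xm lx)) (negbTE (far_s _ _ bs xm lx)).
have km : k \in m by rewrite Em mem_cat mem_head orbT.
pose N x := [set y | e x y].
have hk' : h != k.
  by case: hamc => _ + _; apply: contraTneq => ->; rewrite /= !(mem_cat, inE) km !orbT.
(* Since [h] and [k] are not adjacent, their neighbourhoods lie among [n - 2] vertices and must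
   share at least three. *)
have common : N h :&: N k \subset [set g; p].
  apply/subsetP=> x; rewrite !inE => /andP[ehx ekx].
  have := hamiltonian_mem x hamc; rewrite !(inE, mem_cat) => /or4P[|xs||].
  - by move=> /eqP xh; rewrite xh eirr in ehx.
  - by have := heavy_far k x hk km; rewrite mem_cat xs ekx => /(_ isT).
  - by move=> ->.
  - case/or3P=> [xm||xs]; first by rewrite (negbTE (h_far x xm)) in ehx.
      by move=> ->; rewrite orbT.
    by have := heavy_far k x hk km; rewrite mem_cat xs ekx orbT => /(_ isT).
have outside : N h :|: N k \subset ~: [set h; k].
  apply/subsetP=> x; rewrite !inE; apply: contraTN => /pred2P[] ->; rewrite eirr ?orbF /=.
    by rewrite esym h_far.
  exact: h_far.
have := cardsUI (N h) (N k); have := subset_leq_card common.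
have := subset_leq_card outside; rewrite [#|~: _|]cardsCs setCK !cards2 hk'.
have := max_card [in [set h; k]]; rewrite cards2 hk'.
move: hh hk; rewrite /heavy -[deg e h]/#|N h| -[deg e k]/#|N k|.
by case: (g != p); slia.
Qed.

End Blocks.

Lemma not_two_heavy s : hamiltonian_cycle s -> ~ 1 < #|[set x | heavy x]|.
Proof.
move=> hamc /card_gt1P[h [g [hh hg hg']]]; rewrite !inE in hh hg.
have [i c Er] := rot_to (hamiltonian_mem h hamc).
have {}hamc : hamiltonian_cycle (h :: c).
  by rewrite -Er; apply: hamiltonian_rot; rewrite cat_take_drop.
have gc : g \in c.
  by have := hamiltonian_mem g hamc; rewrite inE eq_sym (negbTE hg').
clear Er.
have [/allP/(_ g gc)|[s1 [g1 [r [E ls1 hg1]]]]] := all_or_split heavy c.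
  by rewrite /= hg.
subst c; have trans : forall x y z, ~~ heavy x -> ~~ heavy y -> ~~ heavy z ->
    same_clique x y -> same_clique y z -> same_clique x z.
  have [b [t Es1]] := block_nonempty hamc hh hg1; rewrite Es1 in hamc.
  exact: same_clique_trans hamc.
have [lr|[s2 [k [r2 [E ls2 hk]]]]] := all_or_split heavy r.
  exact: (two_blocks trans hamc hh hg1).
(* Searching from the end finds the last heavy vertex [p]. *)
subst r; have [lr|[r3 [p [s0 [E ls0 hp]]]]] := all_or_split heavy (rev r2).
  apply: (three_blocks trans hamc) => //.
  by rewrite -all_rev.
have {}E : r2 = rev s0 ++ p :: rev r3.
  by rewrite -[r2]revK E rev_cat rev_cons -cats1 -catA.
subst r2; apply: (four_blocks trans hamc) => //.
by rewrite all_rev.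
Qed.

End HamiltonCycle.

(** * Heavy pairs in induced claws and paths *)

Section InducedCopies.
Variables (T : finType) (e : rel T).
Hypotheses (esym : symmetric e) (eirr : irreflexive e).

Lemma heavy_in_copy n (eR : rel 'I_n) (t : n.-tuple T) : R_f1_heavy e eR -> uniq t ->
  (forall i j, e (tnth t i) (tnth t j) = eR i j) ->
  forall i j k, i != j -> ~~ eR i j -> eR i k -> eR k j ->
  heavy e (tnth t i) || heavy e (tnth t j).
Proof.
move=> Rh ut et i j k ij nij ik kj.
have tinj : injective (tnth t) by apply/tuple_uniqP.
have := Rh (tnth t @: setT) (ex_intro _ (tnth t) (And3 tinj erefl et)) (tnth t i) (tnth t j).
rewrite /dist2_in !imset_f ?inE // (inj_eq tinj) ij et nij /= => /(_ _)/wrap[].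
  by apply/existsP; exists (tnth t k); rewrite imset_f ?inE // !et ik.
by rewrite /heavy maxnMr leq_max.
Qed.

Lemma claw_f1_heavy x a b c : R_f1_heavy e claw_rel ->
  e x a -> e x b -> e x c -> a != b -> a != c -> b != c ->
  ~~ e a b -> ~~ e a c -> ~~ e b c -> heavy e a || heavy e b.
Proof.
move=> Rh xa xb xc ab ac bc eab eac ebc.
have ne y : e x y -> x != y by apply: contraTneq => <-; rewrite eirr.
have ut : uniq [tuple x; a; b; c] by rewrite /= !inE !negb_or (ne _ xa) (ne _ xb) (ne _ xc) ab ac bc.
have et i j : e (tnth [tuple x; a; b; c] i) (tnth [tuple x; a; b; c] j) = claw_rel i j.
  rewrite !(tnth_nth x).
  case: i => [[|[|[|[|?]]]] ?] //; case: j => [[|[|[|[|?]]]] ?] //=;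
  by rewrite /claw_rel /= ?eirr ?xa ?xb ?xc ?(negbTE eab) ?(negbTE eac) ?(negbTE ebc)
     // esym ?xa ?xb ?xc ?(negbTE eab) ?(negbTE eac) ?(negbTE ebc).
by have := heavy_in_copy Rh ut et (i := inord 1) (j := inord 2) (k := inord 0);
  rewrite !(tnth_nth x) /claw_rel -!val_eqE /= !inordK //; apply.
Qed.

Lemma P4_f1_heavy a b c d : R_f1_heavy e P4_rel ->
  e a b -> e b c -> e c d -> ~~ e a c -> ~~ e b d -> ~~ e a d ->
  (heavy e a || heavy e c) && (heavy e b || heavy e d).
Proof.
move=> Rh ab bc cd eac ebd ead.
have ne y z : e y z -> y != z by apply: contraTneq => <-; rewrite eirr.
have ac : a != c by apply: contraTneq cd => <-.
have bd : b != d by apply: contraTneq ab => ->.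
have ad : a != d by apply: contraTneq cd => <-; rewrite esym.
have ut : uniq [tuple a; b; c; d] by rewrite /= !inE !negb_or (ne _ _ ab) (ne _ _ bc) (ne _ _ cd) ac bd ad.
have et i j : e (tnth [tuple a; b; c; d] i) (tnth [tuple a; b; c; d] j) = P4_rel i j.
  rewrite !(tnth_nth a).
  case: i => [[|[|[|[|?]]]] ?] //; case: j => [[|[|[|[|?]]]] ?] //=;
  by rewrite /P4_rel /= ?eirr ?ab ?bc ?cd ?(negbTE eac) ?(negbTE ebd) ?(negbTE ead)
     // esym ?ab ?bc ?cd ?(negbTE eac) ?(negbTE ebd) ?(negbTE ead).
apply/andP; split.
  by have := heavy_in_copy Rh ut et (i := inord 0) (j := inord 2) (k := inord 1);
    rewrite !(tnth_nth a) /P4_rel -!val_eqE /= !inordK //; apply.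
by have := heavy_in_copy Rh ut et (i := inord 1) (j := inord 3) (k := inord 2);
  rewrite !(tnth_nth a) /P4_rel -!val_eqE /= !inordK //; apply.
Qed.

End InducedCopies.

Theorem theorem7 (T : finType) (e : rel T) :
  simple_graph e ->
  two_connected e ->
  ~ is_cycle_graph e ->
  R_f1_heavy e claw_rel ->
  R_f1_heavy e P4_rel ->
  pancyclic e.
Proof.
move=> [es ei] [T3 [con con1]] ncyc clawR P4R k k3n.
(* A boolean form of the goal permits arguing by contradiction. *)
suff /existsP[t ct] : [exists t : k.-tuple T, ucycleb e t].
  by exists t; rewrite size_tuple.
apply: contraT => nk; exfalso.
have npan : ~ pancyclic e.
  move=> /(_ k k3n)[s [/eqP szs cs]]; move/existsP: nk; apply.
  by exists (Tuple szs).
have claw x a b c := @claw_f1_heavy T e es ei x a b c clawR.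
have P4 a b c d := @P4_f1_heavy T e es ei a b c d P4R.
have h2 := two_heavy es ei claw P4 ncyc con con1 T3.
have [s [/andP[cs us] szs]] : exists s, ucycle e s /\ size s = #|T|.
  (* The heavy vertices are pairwise adjacent in the closure, so any enumeration of them is a
     starting cycle. *)
  apply: (hamiltonian_of_closure es ei claw P4 con1 (s := enum (heavy e))).
  - apply: cycle_from_next; first exact: enum_uniq.
    move=> x xs; have ys : next (enum (heavy e)) x \in enum (heavy e) by rewrite mem_next.
    move: (xs) (ys); rewrite !mem_enum => hx hy; apply: clos_heavy => //.
    have [i s' Er] := rot_to xs.
    rewrite -(next_rot i (enum_uniq _)) Er.
    have : size (x :: s') > 1 by rewrite -Er size_rot -cardE -cardsE.
    have := enum_uniq (heavy e); rewrite -(rot_uniq i) Er.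
    case: s' {Er} => [|z s'] //= /andP[+ _] _; rewrite eqxx inE negb_or.
    by case/andP.
  - exact: enum_uniq.
  - by rewrite -cardE -cardsE.
  - by move=> x hx; rewrite mem_enum.
exact: (not_two_heavy es ei claw P4 ncyc npan (And3 cs us szs) h2).
Qed.
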